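(* Let $\mathfrak{g}$ be a Loday algebra and let $\mathcal{A}^{\infty}(\Pi\mathfrak{g}^* ):=C^\infty(\Pi\mathfrak{g}^*_{Lie})\otimes(\uparrow\mathfrak{g})$, where $C^\infty(\Pi\mathfrak{g}_{Lie}^* )=\bigwedge^{\bullet\ge0}\mathfrak{g}_{Lie}$ and $\uparrow\mathfrak{g}$ is a copy of $\mathfrak{g}$ placed in degree $+1$. Then $\mathcal{A}^{\infty}(\Pi\mathfrak{g}^* )$, with the operations $*$ and $\{\cdot,\cdot\}$ defined in the context, is a graded dual-prePoisson algebra whose bracket has degree $-1$ and whose multiplication has degree $0$.
   Context: All vector spaces are over a fixed field of characteristic $0$. A Loday (Leibniz) algebra is a vector space $\mathfrak{g}$ with a bilinear bracket satisfying $[x,[y,z]]=[[x,y],z]+[y,[x,z]]$. Let $\mathfrak{g}^{ann}$ be the span of all $[x,y]+[y,x]$, a two-sided ideal; $\mathfrak{g}_{Lie}:=\mathfrak{g}/\mathfrak{g}^{ann}$ is a Lie algebra, $\bar x$ denotes the image of $x$, and $[x,y]$ depends on $x$ only through $\bar x$. A graded dual-prePoisson algebra with bracket of degree $-1$ and multiplication of degree $0$ is a graded vector space $A$ with an associative multiplication $*$ of degree $0$ and a bilinear bracket $\{\cdot,\cdot\}$ of degree $-1$ such that for all homogeneous $x,y,z$: $x*y*z=(-1)^{|x||y|}y*x*z$; $\{x,\{y,z\}\}=\{\{x,y\},z\}+(-1)^{(|x|-1)(|y|-1)}\{y,\{x,z\}\}$; $\{x,y*z\}=\{x,y\}*z+(-1)^{(|x|-1)|y|}y*\{x,z\}$;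 $\{x*y,z\}=x*\{y,z\}+(-1)^{|x||y|}y*\{x,z\}$; $\{x,y\}*z=-(-1)^{(|x|-1)(|y|-1)}\{y,x\}*z$. $\bigwedge^\bullet\mathfrak{g}_{Lie}$ is graded by exterior degree ($\mathfrak{g}_{Lie}$ in degree $1$) and carries the (linear) Schouten-Nijenhuis bracket: the unique degree $-1$ bracket extending the Lie bracket of $\mathfrak{g}_{Lie}$ with $\{f,g\}=-(-1)^{(|f|-1)(|g|-1)}\{g,f\}$ and $\{f,g\wedge h\}=\{f,g\}\wedge h+(-1)^{(|f|-1)|g|}g\wedge\{f,h\}$. The degree of $f\otimes x\in\bigwedge^\bullet\mathfrak{g}_{Lie}\otimes(\uparrow\mathfrak{g})$ is $|f|+1$; put $g\wedge(h\otimes z)=(g\wedge h)\otimes z$. The operations are, for homogeneous $f,g\in\bigwedge^\bullet\mathfrak{g}_{Lie}$ and $x,y,x_i\in\mathfrak{g}$: $(f\otimes x)*(g\otimes y):=(f\wedge\bar x\wedge g)\otimes y$; $\{\bar x_1\wedge\cdots\wedge\bar x_n,y\}:=\sum_{i=1}^n(-1)^{n-i}\,\bar x_1\wedge\cdots\wedge\bar x_{i-1}\wedge\bar x_{i+1}\wedge\cdots\wedge\bar x_n\otimes[x_i,y]$ (extended linearly to define $\{f,y\}$, with $\{1,y\}=0$); $\{f,g\otimes y\}:=\{f,g\}\otimes y+(-1)^{(|f|-1)|g|}g\wedge\{f,y\}$; $\{f\otimes x,g\otimes y\}:=\{f\wedge\bar x,g\otimes y\}$. *)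

(* Defs.v *)
From HB Require Import structures.
From mathcomp Require Import all_boot all_order all_algebra.
From mathcomp Require Import ring.
From mathcomp Require Import generic_quotient ring_quotient boolp.
From mathcomp.multinomials Require Import freeg.

Set Implicit Arguments.
Unset Strict Implicit.
Unset Printing Implicit Defensive.

Import GRing.Theory.
Local Open Scope ring_scope.
Local Open Scope quotient_scope.

Definition bilin (F : fieldType) (U W M : lmodType F) (h : U -> W -> M) : Prop :=
  (forall w, linear (h^~ w)) /\ (forall u, linear (h u)).

Section LinearFacts.
Context (F : fieldType) (U M : lmodType F) (h : U -> M).
Hypothesis hlin : linear h.

Lemma lin0 : h 0 = 0.
Proof. by have := hlin (-1) 0 0; rewrite scaler0 addr0 scaleN1r addNr. Qed.

Lemma linD u v : h (u + v) = h u + h v.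
Proof. by rewrite -[u]scale1r hlin !scale1r. Qed.

Lemma linZ a u : h (a *: u) = a *: h u.
Proof. by have := hlin a u 0; rewrite lin0 !addr0. Qed.

Lemma linN u : h (- u) = - h u.
Proof. by rewrite -scaleN1r linZ scaleN1r. Qed.

Lemma linB u v : h (u - v) = h u - h v.
Proof. by rewrite linD linN. Qed.

Lemma lin_sum I (r : seq I) (P : pred I) (c : I -> U) :
  h (\sum_(i <- r | P i) c i) = \sum_(i <- r | P i) h (c i).
Proof. exact: (big_morph h linD lin0). Qed.
End LinearFacts.

Section Span.
Context (F : fieldType) (V : lmodType F) (S : V -> Prop).

Definition lspan : {pred V} := fun v =>
  `[< exists2 s : seq (F * V),
        (forall p, p \in s -> S p.2) & v = \sum_(p <- s) p.1 *: p.2 >].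

Lemma lspanP v : reflect (exists2 s : seq (F * V),
  (forall p, p \in s -> S p.2) & v = \sum_(p <- s) p.1 *: p.2) (v \in lspan).
Proof. exact: asboolP. Qed.

Lemma lspan_submod_closed : submod_closed lspan.
Proof.
split=> [|a u v /lspanP[s Ss ->] /lspanP[t St ->]]; apply/lspanP.
  by exists [::]; rewrite ?big_nil.
exists ([seq (a * p.1, p.2) | p <- s] ++ t).
  by move=> p; rewrite mem_cat => /orP[/mapP[q /Ss Sq ->]//|/St].
rewrite big_cat big_map scaler_sumr /=; congr (_ + _).
by apply: eq_bigr => p _; rewrite scalerA.
Qed.

HB.instance Definition _ :=
  GRing.isSubmodClosed.Build F V lspan lspan_submod_closed.

Lemma mem_lspan v : S v -> v \in lspan.
Proof.
move=> Sv; apply/lspanP; exists [:: (1, v)]; last by rewrite big_seq1 scale1r.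
by move=> p; rewrite inE => /eqP->.
Qed.

Lemma lspan_ind (P : V -> Prop) :
    P 0 -> (forall a u v, S u -> P v -> P (a *: u + v)) ->
  forall v, v \in lspan -> P v.
Proof.
move=> P0 PS v /lspanP[s Ss ->]; elim: s Ss => [|p s IHs] Ss.
  by rewrite big_nil.
rewrite big_cons; apply: PS; first by apply: Ss; rewrite mem_head.
by apply: IHs => q sq; apply: Ss; rewrite inE sq orbT.
Qed.

Definition modq : Type := {ideal_quot lspan}.

HB.instance Definition _ := GRing.Zmodule.on modq.
HB.instance Definition _ := Quotient.on modq.

Definition pi (v : V) : modq := \pi_{ideal_quot lspan} v.

Lemma pi_eq u v : (pi u == pi v) = (u - v \in lspan).
Proof. by rewrite Quotient.idealrBE. Qed.

Lemma piD u v : pi (u + v) = pi u + pi v.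
Proof. exact: raddfD. Qed.

Lemma pi_repr (q : modq) : pi (repr q) = q.
Proof. exact: reprK. Qed.

Definition modq_scale (a : F) (q : modq) : modq := pi (a *: repr q).

Lemma piZ a u : pi (a *: u) = modq_scale a (pi u).
Proof.
apply/eqP; rewrite /modq_scale pi_eq -scalerBr rpredZ // -pi_eq.
by rewrite pi_repr.
Qed.

Fact modq_scaleA a b q : modq_scale a (modq_scale b q) = modq_scale (a * b) q.
Proof. by rewrite -[q]pi_repr -!piZ scalerA. Qed.
Fact modq_scale1 : left_id 1 modq_scale.
Proof. by move=> q; rewrite -[q]pi_repr -!piZ scale1r. Qed.
Fact modq_scaleDr : right_distributive modq_scale +%R.
Proof.
move=> a q r; rewrite -[q]pi_repr -[r]pi_repr -piD -!piZ.
by rewrite scalerDr piD.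
Qed.
Fact modq_scaleDl q a b : modq_scale (a + b) q = modq_scale a q + modq_scale b q.
Proof. by rewrite -[q]pi_repr -!piZ -piD scalerDl. Qed.

HB.instance Definition _ := GRing.Zmodule_isLmodule.Build F modq
  modq_scaleA modq_scale1 modq_scaleDr modq_scaleDl.

Lemma pi_lin : linear pi.
Proof. by move=> a u v; rewrite piD piZ. Qed.

Lemma pi0 v : S v -> pi v = 0.
Proof.
by move=> Sv; rewrite -(lin0 pi_lin); apply/eqP; rewrite pi_eq subr0 mem_lspan.
Qed.

(* The map induced on the quotient by h; meaningful when h is linear and
   vanishes on S. *)
Definition qlift (M : Type) (h : V -> M) (q : modq) : M := h (repr q).

Section Lift.
Context (M : lmodType F) (h : V -> M).
Hypotheses (hlin : linear h) (h0 : forall v, S v -> h v = 0).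

Lemma qliftE v : qlift h (pi v) = h v.
Proof.
apply/eqP; rewrite -subr_eq0 /qlift -linB //; apply/eqP.
have: repr (pi v) - v \in lspan by rewrite -pi_eq pi_repr.
elim/lspan_ind => [|a u w Su hw]; first exact: lin0.
by rewrite hlin h0 // hw scaler0 addr0.
Qed.

Lemma qlift_lin : linear (qlift h).
Proof.
move=> a q r; rewrite -[q]pi_repr -[r]pi_repr -pi_lin !qliftE.
exact: hlin.
Qed.
End Lift.
End Span.

Arguments pi {F V} S v.

Section FreeLift.
Context (F : fieldType) (K : choiceType).

Lemma fglift_lin (M : lmodType F) (h : K -> M) : linear (@fglift F M K h).
Proof.
have fgD (D E : {freeg K / F}) : fglift h (D + E) = fglift h D + fglift h E.
  have fgB := @lift_is_additive F K M h.
  have fgN G : fglift h (- G) = - fglift h G.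
    by have := fgB 0 G; have := fgB 0 0; rewrite !sub0r oppr0 subrr => ->; rewrite sub0r.
  by rewrite -[E in LHS]opprK fgB fgN opprK.
have fg0 : fglift h (0 : {freeg K / F}) = 0.
  by apply: (addIr (fglift h 0)); rewrite -fgD !add0r.
have fgsum (s : seq K) (c : K -> F) :
    fglift h (\sum_(x <- s) << c x *g x >>) = \sum_(x <- s) c x *: h x.
  rewrite (big_morph (fglift h) fgD fg0); apply: eq_bigr => x _.
  by rewrite liftU.
move=> a D E; rewrite fgD; congr (_ + _).
have -> : a *: D = fgscale a D by [].
rewrite /fgscale -[in RHS](freeg_sumE D) !fgsum scaler_sumr.
by apply: eq_bigr => x _; rewrite scalerA.
Qed.

Lemma fglift1 (M : lmodType F) (h : K -> M) x :
  fglift h (<< x >> : {freeg K / F}) = h x.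
Proof. by rewrite liftU scale1r. Qed.

Lemma freeg_ind (P : {freeg K / F} -> Prop) :
  P 0 -> (forall a x D, P D -> P (a *: << x >> + D)) -> forall D, P D.
Proof.
move=> P0 PS D; rewrite -[D]freeg_sumE; elim: (dom D) => [|x s IHs].
  by rewrite big_nil.
rewrite big_cons; suff -> : << coeff x D *g x >> = coeff x D *: << x >> :> {freeg K / F}.
  exact: PS.
by apply/eqP/freeg_eqP => y; rewrite coeffZ !coeffU mul1r.
Qed.
End FreeLift.

Section Tensor.
Context (F : fieldType) (U W : lmodType F).

Inductive tensor_rel : {freeg (U * W) / F} -> Prop :=
| TensorL a u u' w :
    tensor_rel (<< (a *: u + u', w) >> - (a *: << (u, w) >> + << (u', w) >>))
| TensorR a u w w' :
    tensor_rel (<< (u, a *: w + w') >> - (a *: << (u, w) >> + << (u, w') >>)).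

Definition tensor : lmodType F := modq tensor_rel.

Definition tens (u : U) (w : W) : tensor := pi tensor_rel << (u, w) >>.

Definition tlift (M : lmodType F) (h : U -> W -> M) : tensor -> M :=
  qlift (fglift (fun p => h p.1 p.2)).

Lemma tens_bilin : bilin tens.
Proof.
split=> [w a u u'|u a w w'] /=; apply/eqP; rewrite /tens -pi_lin -subr_eq0.
  by rewrite -linB ?pi0 //; [constructor | exact: pi_lin].
by rewrite -linB ?pi0 //; [constructor | exact: pi_lin].
Qed.

Lemma tens_ind (P : tensor -> Prop) :
    P 0 -> (forall a u w t, P t -> P (a *: tens u w + t)) -> forall t, P t.
Proof.
move=> P0 PS t; rewrite -[t](@pi_repr F _ tensor_rel).
elim/freeg_ind: (repr _) => [|a [u w] D PD].
  by rewrite (lin0 (@pi_lin _ _ _)).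
by rewrite pi_lin; apply: PS.
Qed.

Section Lift.
Context (M : lmodType F) (h : U -> W -> M).
Hypothesis hbil : bilin h.

Let h0 v : tensor_rel v -> fglift (fun p => h p.1 p.2) v = 0.
Proof.
have lin := fglift_lin (fun p : U * W => h p.1 p.2).
by case=> [a u u' w|a u w w']; rewrite (linB lin) lin !fglift1 /=;
  rewrite ?(hbil.1 w) ?(hbil.2 u) subrr.
Qed.

Lemma tlift_lin : linear (tlift h).
Proof. by apply: qlift_lin h0; exact: fglift_lin. Qed.

Lemma tliftE u w : tlift h (tens u w) = h u w.
Proof. by rewrite /tlift qliftE ?fglift1 //; exact: fglift_lin. Qed.
End Lift.
End Tensor.

Notation "u \ot w" := (tens u w) (at level 40, left associativity) : ring_scope.

Lemma tens_ext (F : fieldType) (U W M : lmodType F) (h k : tensor U W -> M) :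
  linear h -> linear k -> (forall u w, h (u \ot w) = k (u \ot w)) -> h =1 k.
Proof.
move=> hl kl hk; elim/tens_ind => [|a u w t IH]; first by rewrite !lin0.
by rewrite hl kl hk IH.
Qed.

(* The quotient of the free vector space on words v1 ... vn, n >= 0, by
   multilinearity in the letters and by the words with two equal consecutive
   letters; the class of the word v1 ... vn is v1 /\ ... /\ vn. *)
Section Exterior.
Context (F : fieldType) (V : lmodType F).

Inductive ext_rel : {freeg (seq V) / F} -> Prop :=
| ExtLin s a u v t : ext_rel (<< s ++ (a *: u + v) :: t >>
                      - (a *: << s ++ u :: t >> + << s ++ v :: t >>))
| ExtAlt s v t : ext_rel << s ++ v :: v :: t >>.

Definition ext : lmodType F := modq ext_rel.

Definition wd (s : seq V) : ext := pi ext_rel << s >>.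

Definition ext_lift (M : lmodType F) (h : seq V -> M) : ext -> M :=
  qlift (fglift h).

Definition multalt (M : lmodType F) (h : seq V -> M) : Prop :=
  (forall s a u v t,
     h (s ++ (a *: u + v) :: t) = a *: h (s ++ u :: t) + h (s ++ v :: t))
  /\ (forall s v t, h (s ++ v :: v :: t) = 0).

Lemma wd_multalt : multalt wd.
Proof.
split=> [s a u v t|s v t]; last by rewrite /wd pi0 //; constructor.
apply/eqP; rewrite /wd -pi_lin -subr_eq0 -linB ?pi0 //; first by constructor.
exact: pi_lin.
Qed.

Lemma ext_ind (P : ext -> Prop) :
    P 0 -> (forall a s f, P f -> P (a *: wd s + f)) -> forall f, P f.
Proof.
move=> P0 PS f; rewrite -[f](@pi_repr F _ ext_rel).
elim/freeg_ind: (repr _) => [|a s D PD]; first by rewrite (lin0 (@pi_lin _ _ _)).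
by rewrite pi_lin; apply: PS.
Qed.

Section Lift.
Context (M : lmodType F) (h : seq V -> M).
Hypothesis hma : multalt h.

Let h0 v : ext_rel v -> fglift h v = 0.
Proof.
have lin := fglift_lin h.
case=> [s a u w t|s w t]; rewrite ?(linB lin) ?lin !fglift1 ?hma.2 //.
by rewrite hma.1 subrr.
Qed.

Lemma ext_lift_lin : linear (ext_lift h).
Proof. by apply: qlift_lin h0; exact: fglift_lin. Qed.

Lemma ext_liftE s : ext_lift h (wd s) = h s.
Proof. by rewrite /ext_lift qliftE ?fglift1 //; exact: fglift_lin. Qed.
End Lift.

Lemma ext_eq (M : lmodType F) (h k : ext -> M) :
  linear h -> linear k -> (forall s, h (wd s) = k (wd s)) -> h =1 k.
Proof.
move=> hl kl hk; elim/ext_ind => [|a s f IH]; first by rewrite !lin0.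
by rewrite hl kl hk IH.
Qed.

Definition ext_lift2 (M : lmodType F) (h : seq V -> seq V -> M) (f g : ext) : M :=
  ext_lift (fun s => ext_lift (h s) g) f.

Section Lift2.
Context (M : lmodType F) (h : seq V -> seq V -> M).
Hypotheses (hl : forall t, multalt (h^~ t)) (hr : forall s, multalt (h s)).

Let hg g : multalt (fun s => ext_lift (h s) g).
Proof.
elim/ext_ind: g => [|b r g [IH1 IH2]].
  split=> *; rewrite !(lin0 (ext_lift_lin (hr _))) //.
  by rewrite scaler0 addr0.
have E s : ext_lift (h s) (b *: wd r + g) = b *: h s r + ext_lift (h s) g.
  by rewrite (ext_lift_lin (hr s)) (ext_liftE (hr s)).
split=> [s a u v t|s v t]; rewrite !E.
  rewrite (hl r).1 IH1 !scalerDr !scalerA mulrC -!addrA; congr (_ + _).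
  by rewrite [in RHS]addrCA.
by rewrite (hl r).2 IH2 scaler0 addr0.
Qed.

Lemma ext_lift2_bilin : bilin (ext_lift2 h).
Proof.
split=> [g|f a g g']; first exact: ext_lift_lin (hg g).
rewrite /ext_lift2; elim/ext_ind: f => [|b s f IH].
  by rewrite !(lin0 (ext_lift_lin (hg _))) scaler0 addr0.
rewrite !(ext_lift_lin (hg _)) IH !(ext_liftE (hg _)) (ext_lift_lin (hr s)).
rewrite !scalerDr !scalerA mulrC -!addrA; congr (_ + _).
by rewrite addrCA.
Qed.

Lemma ext_lift2E s t : ext_lift2 h (wd s) (wd t) = h s t.
Proof. by rewrite /ext_lift2 (ext_liftE (hg _)) (ext_liftE (hr s)). Qed.
End Lift2.

Definition wedge : ext -> ext -> ext := ext_lift2 (fun s t => wd (s ++ t)).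

(* Degree n part; zero for negative n. *)
Definition extdeg (n : int) : {pred ext} :=
  lspan (fun f => exists2 s : seq V, (size s)%:Z = n & f = wd s).

End Exterior.

Arguments extdeg {F} V n.

Notation "f \wedge g" := (wedge f g) (at level 40, left associativity) : ring_scope.

Section ExteriorFacts.
Context (F : fieldType) (V : lmodType F).
Implicit Types (s t : seq V) (f g h : ext V) (x y : V).

Lemma multalt_lin (M N : lmodType F) (k : M -> N) (h : seq V -> M) :
  linear k -> multalt h -> multalt (fun s => k (h s)).
Proof.
move=> kl [hl ha]; split=> [s a u v t|s v t]; first by rewrite hl kl.
by rewrite ha (lin0 kl).
Qed.

Lemma wedge_word : bilin (@wedge F V) /\
  forall s t, wd s \wedge wd t = wd (s ++ t).
Proof.
have hl t : multalt (fun s => wd (s ++ t)).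
  split=> [s a u v r|s v r]; rewrite -!catA /=; first exact: (wd_multalt V).1.
  exact: (wd_multalt V).2.
have hr s : multalt (fun t => wd (s ++ t)).
  split=> [r a u v t|r v t]; rewrite !catA; first exact: (wd_multalt V).1.
  exact: (wd_multalt V).2.
by split; [exact: ext_lift2_bilin | exact: ext_lift2E].
Qed.

Lemma wedge_bilin : bilin (@wedge F V). Proof. exact: wedge_word.1. Qed.

Lemma wedgeE s t : wd s \wedge wd t = wd (s ++ t).
Proof. exact: wedge_word.2. Qed.

Lemma wedge_linl g : linear (fun f => f \wedge g).
Proof. exact: wedge_bilin.1. Qed.
Lemma wedge_linr f : linear (wedge f).
Proof. exact: wedge_bilin.2. Qed.

Lemma comp_lin (U W M : lmodType F) (k : W -> M) (h : U -> W) :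
  linear k -> linear h -> linear (fun u => k (h u)).
Proof. by move=> kl hl a u v; rewrite hl kl. Qed.

Lemma add_lin (U M : lmodType F) (h k : U -> M) :
  linear h -> linear k -> linear (fun u => h u + k u).
Proof. by move=> hl kl a u v; rewrite hl kl scalerDr addrACA. Qed.

Lemma scale_lin (U M : lmodType F) (h : U -> M) c :
  linear h -> linear (fun u => c *: h u).
Proof. by move=> hl a u v; rewrite hl scalerDr !scalerA mulrC. Qed.

Lemma opp_lin (U M : lmodType F) (h : U -> M) :
  linear h -> linear (fun u => - h u).
Proof. by move=> hl a u v; rewrite hl opprD scalerN. Qed.

Lemma wedgeA f g h : f \wedge (g \wedge h) = f \wedge g \wedge h.
Proof.
apply: (@ext_eq _ _ _ (fun f => f \wedge (g \wedge h))
                      (fun f => f \wedge g \wedge h)) => [||s].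
- exact: wedge_linl.
- by apply: comp_lin; exact: wedge_linl.
apply: (@ext_eq _ _ _ (fun g => wd s \wedge (g \wedge h))
                      (fun g => wd s \wedge g \wedge h)) => [||t].
- by apply: comp_lin; [exact: wedge_linr | exact: wedge_linl].
- by apply: comp_lin; [exact: wedge_linl | exact: wedge_linr].
apply: (@ext_eq _ _ _ (fun h => wd s \wedge (wd t \wedge h))
                      (fun h => wd s \wedge wd t \wedge h)) => [||r].
- by apply: comp_lin; exact: wedge_linr.
- exact: wedge_linr.
by rewrite !wedgeE catA.
Qed.

Lemma wedge1l f : wd [::] \wedge f = f.
Proof.
by move: f; apply: ext_eq => [||s] //; [exact: wedge_linr | rewrite wedgeE].
Qed.

Lemma wedge1r f : f \wedge wd [::] = f.
Proof.
move: f; apply: (@ext_eq _ _ _ (fun f => f \wedge wd [::])) => [||s] //.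
  exact: wedge_linl.
by rewrite wedgeE cats0.
Qed.

Lemma wd_cons x s : wd (x :: s) = wd [:: x] \wedge wd s.
Proof. by rewrite wedgeE. Qed.

Lemma wd_swap s x y t : wd (s ++ x :: y :: t) = - wd (s ++ y :: x :: t).
Proof.
apply/eqP; rewrite -addr_eq0; apply/eqP.
have [L A] := wd_multalt V; rewrite -(A s (x + y) t).
have D (r : seq V) (u v : V) q : wd (r ++ (u + v) :: q) = wd (r ++ u :: q) + wd (r ++ v :: q).
  by have := L r 1 u v q; rewrite !scale1r.
rewrite D -!(cat_rcons x) -!(cat_rcons y) !D !cat_rcons !A add0r addr0.
by [].
Qed.

Lemma wedge_swap x y : wd [:: x] \wedge wd [:: y] = - (wd [:: y] \wedge wd [:: x]).
Proof. by rewrite !wedgeE (wd_swap [::]). Qed.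

Lemma wedge_letterC x t :
  wd [:: x] \wedge wd t = (-1) ^+ size t *: (wd t \wedge wd [:: x]).
Proof.
elim: t => [|y t IH]; first by rewrite wedge1l wedge1r scale1r.
rewrite (wd_cons y t) wedgeA wedge_swap (linN (wedge_linl _)) -wedgeA IH.
by rewrite (linZ (wedge_linr _)) wedgeA -scaleNr exprS mulN1r.
Qed.

Lemma wedge_wordC s t :
  wd s \wedge wd t = (-1) ^+ (size s * size t) *: (wd t \wedge wd s).
Proof.
elim: s => [|x s IH]; first by rewrite wedge1l wedge1r scale1r.
rewrite (wd_cons x s) -wedgeA IH (linZ (wedge_linr _)) wedgeA wedge_letterC.
rewrite (linZ (wedge_linl _)) scalerA -exprD -wedgeA /= mulSn addnC.
by [].
Qed.

Lemma extdeg_wd s : wd s \in extdeg V (size s)%:Z.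
Proof. by apply: mem_lspan; exists s. Qed.

Lemma extdeg_eq (M : lmodType F) n (h k : ext V -> M) :
    linear h -> linear k ->
    (forall s, (size s)%:Z = n -> h (wd s) = k (wd s)) ->
  forall f, f \in extdeg V n -> h f = k f.
Proof.
move=> hl kl hk f; elim/lspan_ind => [|a u g [s sn ->] IH].
  by rewrite !lin0.
by rewrite hl kl hk // IH.
Qed.

Lemma extdeg_sub (M : lmodType F) n (h : ext V -> M) (S : submodClosed M) :
    linear h -> (forall s, (size s)%:Z = n -> h (wd s) \in S) ->
  forall f, f \in extdeg V n -> h f \in S.
Proof.
move=> hl hs f; elim/lspan_ind => [|a u g [s sn ->] IH].
  by rewrite lin0 ?rpred0.
by rewrite hl rpredD // rpredZ // hs.
Qed.

Lemma wedge_deg p q f g : f \in extdeg V p -> g \in extdeg V q ->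
  f \wedge g \in extdeg V (p + q).
Proof.
move=> fp gq; move: f fp; apply: extdeg_sub => [|s sp].
  exact: wedge_linl.
move: g gq; apply: extdeg_sub => [|t tq]; first exact: wedge_linr.
by rewrite wedgeE -sp -tq -PoszD -size_cat extdeg_wd.
Qed.

Definition contr (M : lmodType F) (theta : ext V -> V -> M) (s : seq V) : M :=
  \sum_(i < size s) (-1) ^+ (size s - i.+1) *:
     theta (wd (take i s ++ drop i.+1 s)) (nth 0 s i).

Lemma contr_nil (M : lmodType F) (theta : ext V -> V -> M) :
  contr theta [::] = 0.
Proof. exact: big_ord0. Qed.

Lemma contr_cons (M : lmodType F) (theta : ext V -> V -> M) x s :
  contr theta (x :: s) = (-1) ^+ size s *: theta (wd s) x
     + contr (fun f => theta (wd [:: x] \wedge f)) s.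
Proof.
rewrite /contr /= big_ord_recl /= drop0 subn1 /=; congr (_ + _).
by apply: eq_bigr => i _; rewrite wedgeE.
Qed.

Lemma eq_contr (M : lmodType F) (th1 th2 : ext V -> V -> M) s :
  (forall f x, th1 f x = th2 f x) -> contr th1 s = contr th2 s.
Proof. by move=> e; apply: eq_bigr => i _; rewrite e. Qed.

Lemma contr_lin (M : lmodType F) (th1 th2 : ext V -> V -> M) a s :
  contr (fun f x => a *: th1 f x + th2 f x) s = a *: contr th1 s + contr th2 s.
Proof.
rewrite /contr scaler_sumr -big_split /=; apply: eq_bigr => i _.
by rewrite scalerDr !scalerA mulrC.
Qed.

Lemma contr_map (M N : lmodType F) (k : M -> N) (th : ext V -> V -> M) s :
  linear k -> contr (fun f x => k (th f x)) s = k (contr th s).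
Proof.
move=> kl; rewrite /contr (lin_sum kl); apply: eq_bigr => i _.
by rewrite (linZ kl).
Qed.

Lemma bilin_wedge (M : lmodType F) (theta : ext V -> V -> M) f :
  bilin theta -> bilin (fun g => theta (f \wedge g)).
Proof.
move=> [tl tr]; split=> // x; apply: comp_lin (tl x) _; exact: wedge_linr.
Qed.

Lemma contr_multalt (M : lmodType F) (theta : ext V -> V -> M) :
  bilin theta -> multalt (contr theta).
Proof.
move=> thb; split=> [s a u v t|s v t].
  elim: s theta thb => [|x s IH] theta thb /=; rewrite !contr_cons.
    rewrite (thb.2 (wd t)) scalerDr scalerA mulrC -scalerA.
    rewrite [X in _ + X](_ : _ =
      contr (fun f y => a *: theta (wd [:: u] \wedge f) y
                           + theta (wd [:: v] \wedge f) y) t).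
      by rewrite contr_lin scalerDr addrACA.
    apply: eq_contr => f y.
    by rewrite -(thb.1 y) -wedge_linl -((wd_multalt V).1 [::]).
  rewrite IH; last exact: bilin_wedge.
  rewrite (wd_multalt V).1 (thb.1 x) !size_cat /=.
  by rewrite !scalerDr !scalerA addrACA [a * _]mulrC.
elim: s theta thb => [|x s IH] theta thb /=.
  rewrite !contr_cons -!wd_cons /= addrA -scalerDl exprS mulN1r addNr scale0r.
  rewrite add0r /contr big1 // => i _; rewrite wedgeA wedgeE.
  by rewrite ((wd_multalt V).2 [::]) (lin0 (wedge_linl _)) (lin0 (thb.1 _)) scaler0.
rewrite contr_cons IH; last exact: bilin_wedge.
by rewrite (wd_multalt V).2 (lin0 (thb.1 _)) scaler0 addr0.
Qed.

Lemma signz_nat (m : nat) : (-1) ^ m%:Z = (-1) ^+ m :> F.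
Proof. by []. Qed.

Lemma signzD (m n : int) : (-1) ^ (m + n) = (-1) ^ m * (-1) ^ n :> F.
Proof. by rewrite expfzDr // oppr_eq0 oner_eq0. Qed.

Lemma signz_odd (m n k : int) : m = n + 2 * k -> (-1) ^ m = (-1) ^ n :> F.
Proof. by move=> ->; rewrite signzD -exprz_exp (_ : (-1) ^ 2 = 1) ?exp1rz ?mulr1 //; exact: sqrr_sign 1%N. Qed.
Lemma sgn_eq (m n : nat) : odd m = odd n -> (-1) ^+ m = (-1) ^+ n :> F.
Proof. by move=> e; rewrite -signr_odd e signr_odd. Qed.

Lemma sgnz_nat (m n : nat) :
  (-1) ^ ((m%:Z - 1) * n%:Z) = (-1) ^+ (m.+1 * n) :> F.
Proof.
rewrite -signz_nat PoszM intS; apply: (@signz_odd _ _ (- n%:Z)); ring.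
Qed.

Lemma sgnz_nat2 (m n : nat) :
  (-1) ^ ((m%:Z - 1) * (n%:Z - 1)) = (-1) ^+ (m.+1 * n.+1) :> F.
Proof.
rewrite -signz_nat PoszM !intS; apply: (@signz_odd _ _ (- m%:Z - n%:Z)); ring.
Qed.
End ExteriorFacts.

(* The properties which characterise the Schouten-Nijenhuis bracket on the
   exterior algebra of a Lie algebra L with bracket b. *)
Record is_schouten (F : fieldType) (L : lmodType F) (b : L -> L -> L)
    (sn : ext L -> ext L -> ext L) : Prop := IsSchouten {
  schouten_bilin : bilin sn;
  schouten_deg : forall (p q : int) (f g : ext L),
    f \in extdeg L p -> g \in extdeg L q -> sn f g \in extdeg L (p + q - 1);
  schouten_lie : forall x y : L, sn (wd [:: x]) (wd [:: y]) = wd [:: b x y];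
  schouten_anti : forall (p q : int) (f g : ext L),
    f \in extdeg L p -> g \in extdeg L q ->
    sn f g = - ((-1) ^ ((p - 1) * (q - 1)) *: sn g f);
  schouten_der : forall (p q r : int) (f g h : ext L),
    f \in extdeg L p -> g \in extdeg L q -> h \in extdeg L r ->
    sn f (g \wedge h) =
      sn f g \wedge h + (-1) ^ ((p - 1) * q) *: (g \wedge sn f h)
}.

Section SchoutenUnique.
Context (F : fieldType) (L : lmodType F) (b : L -> L -> L).

Lemma schouten1 sn (s : seq L) : is_schouten b sn -> sn (wd s) (wd [::]) = 0.
Proof.
move=> H; have := schouten_der H (extdeg_wd s) (extdeg_wd [::]) (extdeg_wd [::]).
rewrite wedgeE wedge1r wedge1l mulr0 expr0z scale1r /= => /eqP.
by rewrite -subr_eq0 opprD addrA subrr sub0r oppr_eq0 => /eqP.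
Qed.

Lemma schouten_unique sn1 sn2 :
  is_schouten b sn1 -> is_schouten b sn2 -> forall f g, sn1 f g = sn2 f g.
Proof.
move=> H1 H2.
have step s : (forall y, sn1 (wd s) (wd [:: y]) = sn2 (wd s) (wd [:: y])) ->
    forall t, sn1 (wd s) (wd t) = sn2 (wd s) (wd t).
  move=> e; elim=> [|y t IH]; first by rewrite !schouten1.
  have D sn (H : is_schouten b sn) :=
    schouten_der H (extdeg_wd s) (extdeg_wd [:: y]) (extdeg_wd t).
  by rewrite (wd_cons y t) (D _ H1) (D _ H2) e IH.
have e1 x t : sn1 (wd [:: x]) (wd t) = sn2 (wd [:: x]) (wd t).
  by apply: step => y; rewrite (schouten_lie H1) (schouten_lie H2).
have e2 s t : sn1 (wd s) (wd t) = sn2 (wd s) (wd t).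
  apply: step => y.
  rewrite (schouten_anti H1 (extdeg_wd s) (extdeg_wd [:: y])).
  by rewrite (schouten_anti H2 (extdeg_wd s) (extdeg_wd [:: y])) e1.
move=> f g; have [l1 r1] := schouten_bilin H1; have [l2 r2] := schouten_bilin H2.
move: f; apply: (@ext_eq _ _ _ (sn1^~ g) (sn2^~ g)) => // s.
by move: g; apply: ext_eq.
Qed.
End SchoutenUnique.

Section SchoutenExists.
Context (F : fieldType) (L : lmodType F) (b : L -> L -> L).
Hypotheses (bb : bilin b) (banti : forall x y, b x y = - b y x).
Implicit Types (s t : seq L) (f g h : ext L) (x y : L).

Let adw x := fix adw s : ext L :=
  if s is y :: s' then wd [:: b x y] \wedge wd s' + wd [:: y] \wedge adw s'
  else 0.

Let lin1 (a : F) x y : wd [:: a *: x + y] = a *: wd [:: x] + wd [:: y].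
Proof. exact: ((wd_multalt L).1 [::] a x y [::]). Qed.

Let adw_multalt x : multalt (adw x).
Proof.
split=> [s a u v t|s v t]; elim: s => [|y s IH] /=.
- rewrite (bb.2 x) !lin1 !(wedge_linl _ _ _ _).
  by rewrite scalerDr addrACA.
- rewrite IH (wd_multalt L).1 !(wedge_linr _ _ _ _).
  by rewrite scalerDr addrACA.
- rewrite (linD (wedge_linr _)) !wedgeA (wd_cons v t) wedgeA (wedge_swap v).
  rewrite (linN (wedge_linl _)) addrA subrr add0r.
  by rewrite wedgeE ((wd_multalt L).2 [::]) (lin0 (wedge_linl _)).
by rewrite IH (wd_multalt L).2 !(lin0 (wedge_linr _)) addr0.
Qed.

Let ad x f := ext_lift (adw x) f.

Let ad_lin x : linear (ad x). Proof. exact: ext_lift_lin. Qed.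

Let adE x s : ad x (wd s) = adw x s. Proof. exact: ext_liftE. Qed.

Let ad_linl f : linear (ad^~ f).
Proof.
move=> a x y; elim/ext_ind: f => [|c s f IH].
  by rewrite !(lin0 (ad_lin _)) scaler0 addr0.
rewrite !(ad_lin _ _ _ _) IH !adE.
suff -> : adw (a *: x + y) s = a *: adw x s + adw y s.
  rewrite !scalerDr !scalerA mulrC -!addrA; congr (_ + _); by rewrite addrCA.
elim: s => [|z s IHs] /=; first by rewrite scaler0 addr0.
by rewrite (bb.1 z) lin1 IHs (wedge_linl _ _ _ _) (wedge_linr _ _ _ _)
           scalerDr addrACA.
Qed.

Let ad_cons x y s :
  ad x (wd (y :: s)) = wd [:: b x y] \wedge wd s + wd [:: y] \wedge ad x (wd s).
Proof. by rewrite !adE. Qed.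

Let ad1 x y : ad x (wd [:: y]) = wd [:: b x y].
Proof. by rewrite ad_cons adE /= wedge1r (lin0 (wedge_linr _)) addr0. Qed.

Let ad_deg x n f : f \in extdeg L n -> ad x f \in extdeg L n.
Proof.
move: f; apply: extdeg_sub => [//|s <-]; elim: s => [|y s IH].
  by rewrite adE /= rpred0.
rewrite ad_cons rpredD //; first by rewrite wedgeE; exact: extdeg_wd.
rewrite /= -[_.+1%:Z]/((1 + size s)%N%:Z) PoszD; apply: wedge_deg => //.
exact: (extdeg_wd [:: y]).
Qed.

Let ad_der x g h : ad x (g \wedge h) = ad x g \wedge h + g \wedge ad x h.
Proof.
move: g; apply: (@ext_eq _ _ _ (fun g => ad x (g \wedge h))
    (fun g => ad x g \wedge h + g \wedge ad x h)) => [||s].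
- by apply: comp_lin (@wedge_linl _ _ h).
- move=> a u v /=; rewrite ad_lin !(wedge_linl _ _ _ _).
  by rewrite scalerDr addrACA.
elim: s => [|y s IH].
  by rewrite !wedge1l adE /= (lin0 (wedge_linl _)) add0r.
rewrite (wd_cons y s) -wedgeA.
have ad_y k : ad x (wd [:: y] \wedge k)
    = wd [:: b x y] \wedge k + wd [:: y] \wedge ad x k.
  move: k; apply: (@ext_eq _ _ _ (fun k => ad x (wd [:: y] \wedge k))
    (fun k => wd [:: b x y] \wedge k + wd [:: y] \wedge ad x k)) => [||r].
  - by apply: comp_lin (@wedge_linr _ _ _).
  - move=> a u v /=; rewrite ad_lin !(wedge_linr _ _ _ _).
    by rewrite scalerDr addrACA.
  by rewrite -wd_cons ad_cons.
rewrite !ad_y IH (linD (wedge_linr _)) (linD (wedge_linl _)) !wedgeA.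
by rewrite addrA.
Qed.

Let theta g f x := f \wedge ad x g.

Let theta_bilin g : bilin (theta g).
Proof.
split=> [x|f]; first exact: wedge_linl.
by apply: comp_lin (ad_linl g); exact: wedge_linr.
Qed.

Let sn f g := ext_lift (contr (theta g)) f.

Let snE s g : sn (wd s) g = contr (theta g) s.
Proof. by rewrite /sn ext_liftE //; exact: contr_multalt. Qed.

Let sn_linl g : linear (sn^~ g).
Proof. by apply: ext_lift_lin; exact: contr_multalt. Qed.

Let sn_linr f : linear (sn f).
Proof.
move=> a g h; elim/ext_ind: f => [|c s f IH].
  by rewrite !(lin0 (sn_linl _)) scaler0 addr0.
rewrite !(sn_linl _ _ _ _) IH !snE.
rewrite (_ : contr (theta (a *: g + h)) s =
             a *: contr (theta g) s + contr (theta h) s).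
  rewrite !scalerDr !scalerA mulrC -!addrA; congr (_ + _); by rewrite addrCA.
rewrite -contr_lin; apply: eq_contr => k x.
by rewrite /theta ad_lin wedge_linr.
Qed.

Let sn_nil g : sn (wd [::]) g = 0.
Proof. by rewrite snE contr_nil. Qed.

Let sn_cons x s g : sn (wd (x :: s)) g =
  (-1) ^+ size s *: (wd s \wedge ad x g) + wd [:: x] \wedge sn (wd s) g.
Proof.
rewrite !snE contr_cons -(contr_map _ _ (@wedge_linr _ _ _)); congr (_ + _).
by apply: eq_contr => f y; rewrite /theta wedgeA.
Qed.

Let sn_letter x g : sn (wd [:: x]) g = ad x g.
Proof.
by rewrite sn_cons scale1r wedge1l sn_nil (lin0 (wedge_linr _)) addr0.
Qed.

Let sn_letterr s x : sn (wd s) (wd [:: x]) = - ad x (wd s).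
Proof.
elim: s => [|y s IH]; first by rewrite sn_nil adE oppr0.
rewrite sn_cons IH ad1 ad_cons opprD; congr (_ + _); last first.
  by rewrite (linN (wedge_linr _)).
rewrite banti wedge_letterC.
have -> : wd [:: - b x y] = - wd [:: b x y] :> ext L.
  by apply: (@linN _ _ _ (fun z => wd [:: z])) => c u v; exact: lin1.
by rewrite (linN (wedge_linr _)) scalerN.
Qed.

Let sn_nilr s : sn (wd s) (wd [::]) = 0.
Proof.
elim: s => [|x s IH]; first exact: sn_nil.
by rewrite sn_cons IH adE /= !(lin0 (wedge_linr _)) scaler0 addr0.
Qed.

Let sn_deg p q f g :
  f \in extdeg L p -> g \in extdeg L q -> sn f g \in extdeg L (p + q - 1).
Proof.
move=> fp gq; move: f fp; apply: extdeg_sub => [//|s <-].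
elim: s => [|x s IH]; first by rewrite sn_nil rpred0.
rewrite sn_cons; have -> : (size (x :: s))%:Z + q - 1 = (size s)%:Z + q.
  by rewrite /= intS; ring.
rewrite rpredD ?rpredZ //; first by apply: wedge_deg (extdeg_wd s) (ad_deg x gq).
rewrite [_ + q](_ : _ = 1 + ((size s)%:Z + q - 1)); last by ring.
exact: wedge_deg (extdeg_wd [:: x]) IH.
Qed.

Let sn_der s t h : sn (wd s) (wd t \wedge h) =
  sn (wd s) (wd t) \wedge h
  + (-1) ^+ ((size s).+1 * size t) *: (wd t \wedge sn (wd s) h).
Proof.
elim: s => [|x s IH].
  by rewrite !sn_nil (lin0 (wedge_linl _)) (lin0 (wedge_linr _)) scaler0 addr0.
rewrite !sn_cons IH ad_der !(linD (wedge_linl _)) !(linD (wedge_linr _)).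
rewrite !(linZ (wedge_linl _)) !(linZ (wedge_linr _)) !scalerDr !scalerA.
rewrite !wedgeA -!addrA; congr (_ + _).
rewrite addrCA; congr (_ + _).
rewrite (wedge_wordC s t) !(linZ (wedge_linl _)) scalerA.
rewrite (wedge_letterC x t) !(linZ (wedge_linl _)) scalerA.
congr (_ *: _ + _ *: _); rewrite -!exprD; apply: sgn_eq; rewrite /= !(oddD, oddM) /=;
  by case: (odd _); case: (odd _).
Qed.

Let sn_anti s t : sn (wd s) (wd t) =
  - ((-1) ^+ ((size s).+1 * (size t).+1) *: sn (wd t) (wd s)).
Proof.
elim: s => [|x s IH]; first by rewrite sn_nil sn_nilr scaler0 oppr0.
rewrite sn_cons (wd_cons x s) sn_der sn_letterr IH (linN (wedge_linl _)).
have -> : ad x (wd t) \wedge wd s =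
    (-1) ^+ (size t * size s) *: (wd s \wedge ad x (wd t)).
  have := ad_deg x (extdeg_wd t); move: (ad x _).
  apply: extdeg_eq => [||r [<-]]; first exact: wedge_linl.
    move=> a u v; rewrite (wedge_linr _ _ _ _) scalerDr !scalerA.
    by rewrite [a * _]mulrC.
  exact: wedge_wordC.
rewrite (linN (wedge_linr _)) (linZ (wedge_linr _)).
rewrite !scalerDr !scalerN opprD opprK -!scaleNr !scalerA.
rewrite mulNr -!exprD; congr (_ *: _ + (- _) *: _).
  by apply: sgn_eq; rewrite /= !(oddD, oddM) /=;
  case: (odd _); case: (odd _).
by apply: sgn_eq; rewrite /= !(oddD, oddM) /=; case: (odd _); case: (odd _).
Qed.

Lemma schouten_exists : exists sn, is_schouten b sn.
Proof.
exists sn; split.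
- by split=> [g|f]; [exact: sn_linl | exact: sn_linr].
- exact: sn_deg.
- by move=> x y; rewrite sn_letter ad1.
- move=> p q f g fp gq; move: f fp; apply: extdeg_eq => [||s sp] /=.
  + exact: sn_linl.
  + by apply: opp_lin; apply: scale_lin.
  move: g gq; apply: extdeg_eq => [||t tq] /=.
  + exact: sn_linr.
  + by apply: opp_lin; apply: scale_lin.
  by rewrite sn_anti -sp -tq sgnz_nat2.
move=> p q r f g h fp gq _; move: f fp; apply: extdeg_eq => [||s sp] /=.
+ exact: sn_linl.
+ apply: add_lin; first by apply: comp_lin (sn_linl g); exact: wedge_linl.
  by apply: scale_lin; apply: comp_lin (sn_linl h); exact: wedge_linr.
move: g gq; apply: extdeg_eq => [||t tq] /=.
+ by apply: comp_lin (@wedge_linl _ _ h).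
+ apply: add_lin; first by apply: comp_lin (sn_linr _); exact: wedge_linl.
  by apply: scale_lin; exact: wedge_linl.
by rewrite sn_der -sp -tq sgnz_nat.
Qed.
End SchoutenExists.

HB.mixin Record isLoday (F : fieldType) g of GRing.Lmodule F g := {
  lbr : g -> g -> g;
  lbr_bilin : bilin lbr;
  lbr_loday : forall x y z : g,
    lbr x (lbr y z) = lbr (lbr x y) z + lbr y (lbr x z)
}.

#[short(type="lodayType")]
HB.structure Definition Loday (F : fieldType) :=
  {g of GRing.Lmodule F g & isLoday F g}.

Section LieQuotient.
Context (F : fieldType) (g : lodayType F).

Definition is_sym (z : g) : Prop := exists x y : g, z = lbr x y + lbr y x.

(* g^ann is lspan is_sym, and g_Lie is the quotient of g by it. *)
Definition gLie : lmodType F := modq is_sym.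

Definition bar (x : g) : gLie := pi is_sym x.

(* [x, y] as a function of the class of x *)
Definition lact (a : gLie) (y : g) : g := qlift (fun x => lbr x y) a.

Definition lie (a b : gLie) : gLie := qlift (fun y => bar (lact a y)) b.

Lemma lbr_sym (z y : g) : is_sym z -> lbr z y = 0.
Proof.
case=> u [v ->]; rewrite (linD ((@lbr_bilin F g).1 y)).
apply: (addIr (lbr v (lbr u y))); rewrite add0r addrAC -lbr_loday.
by rewrite addrC -lbr_loday.
Qed.

Lemma bar_lin : linear bar. Proof. exact: pi_lin. Qed.

Lemma lactE x y : lact (bar x) y = lbr x y.
Proof.
apply: (@qliftE _ _ _ g (fun x => lbr x y)); first exact: (@lbr_bilin F g).1.
by move=> v; exact: lbr_sym.
Qed.

Lemma lact_bilin : bilin lact.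
Proof.
split=> [y|a].
  apply: (@qlift_lin _ _ is_sym _ (fun x => lbr x y)).
    exact: (@lbr_bilin F g).1.
  by move=> v; exact: lbr_sym.
by rewrite -[a]pi_repr => b u v; rewrite !lactE (@lbr_bilin F g).2.
Qed.

Let bar_lact_lin a : linear (fun y => bar (lact a y)).
Proof. by apply: comp_lin bar_lin (lact_bilin.2 a). Qed.

Let bar_lact_sym a z : is_sym z -> bar (lact a z) = 0.
Proof.
rewrite -[a]pi_repr; move: (repr a) => x [u [v ->]].
rewrite lactE (linD ((@lbr_bilin F g).2 x)) (lbr_loday x u) (lbr_loday x v).
rewrite [X in bar X](_ : _ = (lbr (lbr x u) v + lbr v (lbr x u))
                           + (lbr u (lbr x v) + lbr (lbr x v) u)).
  rewrite (linD bar_lin) /bar !pi0 ?addr0 //; first by exists u, (lbr x v).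
  by exists (lbr x u), v.
by rewrite -!addrA; congr (_ + _); rewrite addrC -!addrA addrC -!addrA.
Qed.

Lemma lieE x y : lie (bar x) (bar y) = bar (lbr x y).
Proof. by rewrite /lie qliftE ?lactE //; exact: bar_lact_sym. Qed.

Lemma lie_bilin : bilin lie.
Proof.
split=> [b|a]; last first.
  apply: (@qlift_lin _ _ _ _ (fun y => bar (lact a y))) => // z.
  exact: bar_lact_sym.
move=> c u v; rewrite /lie /qlift (lact_bilin.1 _) bar_lin.
by [].
Qed.

Lemma lie_anti a b : lie a b = - lie b a.
Proof.
rewrite -[a]pi_repr -[b]pi_repr; move: (repr a) (repr b) => x y.
rewrite !lieE; apply/eqP; rewrite -addr_eq0 -(linD bar_lin); apply/eqP.
by apply: pi0; exists x, y.
Qed.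

Lemma lie_jacobi a b c : lie a (lie b c) = lie (lie a b) c + lie b (lie a c).
Proof.
rewrite -[a]pi_repr -[b]pi_repr -[c]pi_repr -!/(bar _).
move: (repr a) (repr b) (repr c) => x y z.
by rewrite !lieE lbr_loday (linD bar_lin).
Qed.

End LieQuotient.

Section Operations.
Context (F : fieldType) (g : lodayType F).

Notation Lam := (ext (gLie g)).

(* The only bracket satisfying is_schouten, by schouten_unique. *)
Definition schouten : Lam -> Lam -> Lam :=
  sval (cid (schouten_exists (lie_bilin g) (@lie_anti F g))).

Lemma schoutenP : is_schouten (@lie F g) schouten.
Proof. exact: svalP. Qed.

Definition Ainfty : lmodType F := tensor Lam g.

(* g /\ (h (x) z) = (g /\ h) (x) z *)
Definition wact (f : Lam) (m : Ainfty) : Ainfty :=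
  tlift (fun h z => (f \wedge h) \ot z) m.

(* {x1 /\ ... /\ xn, y}; letters are numbered from 0. *)
Definition ebr_word (s : seq (gLie g)) (y : g) : Ainfty :=
  \sum_(i < size s) (-1) ^+ (size s - i.+1) *:
     (wd (take i s ++ drop i.+1 s) \ot lact (nth 0 s i) y).

Definition ebr (f : Lam) (y : g) : Ainfty := ext_lift (ebr_word^~ y) f.

(* The bilinear extension of (-1)^((|f|-1)|h|) h /\ {f, y} *)
Definition tbr (f h : Lam) (y : g) : Ainfty :=
  ext_lift2 (fun s t => (-1) ^ (((size s)%:Z - 1) * (size t)%:Z) *:
                          wact (wd t) (ebr (wd s) y)) f h.

(* {f, h (x) y} *)
Definition mbr (f : Lam) (m : Ainfty) : Ainfty :=
  tlift (fun h y => schouten f h \ot y + tbr f h y) m.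

(* f (x) x |-> f /\ bar x *)
Definition rho (m : Ainfty) : Lam :=
  tlift (fun f x => f \wedge wd [:: bar x]) m.

Definition Amul (m n : Ainfty) : Ainfty := wact (rho m) n.

Definition Abr (m n : Ainfty) : Ainfty := mbr (rho m) n.

(* \uparrow g sits in degree 1, so f (x) x has degree |f| + 1. *)
Definition Adeg (n : int) : {pred Ainfty} :=
  lspan (fun m => exists f x, f \in extdeg (gLie g) (n - 1) /\ m = f \ot x).

Let wact_aux (f : Lam) : bilin (fun h (z : g) => (f \wedge h) \ot z).
Proof.
split=> [z|h]; last exact: (tens_bilin _ _).2.
by apply: comp_lin ((tens_bilin _ _).1 z) _; exact: wedge_linr.
Qed.

Lemma wactE f h z : wact f (h \ot z) = (f \wedge h) \ot z.
Proof. by rewrite /wact (tliftE (wact_aux f)). Qed.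

Lemma wact_bilin : bilin wact.
Proof.
have wr f : linear (wact f) := tlift_lin (wact_aux f).
split=> // m a f h; elim/tens_ind: m => [|c k z m IH].
  by rewrite !(lin0 (wr _)) scaler0 addr0.
rewrite !(wr _ c) !wactE IH (wedge_linl k) (tens_bilin _ _).1.
rewrite !scalerDr !scalerA mulrC -!addrA; congr (_ + _).
by rewrite addrCA.
Qed.

Lemma ebrE s y : ebr (wd s) y = ebr_word s y.
Proof.
rewrite /ebr ext_liftE //.
apply: (@contr_multalt _ _ _ (fun f x => f \ot lact x y)).
split=> [x|f]; first exact: (tens_bilin _ _).1.
by apply: comp_lin ((tens_bilin _ _).2 f) _; exact: (lact_bilin g).1.
Qed.

Lemma ebr1 y : ebr (wd [::]) y = 0.
Proof. by rewrite ebrE /ebr_word big_ord0. Qed.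

Lemma ebr_bilin : bilin ebr.
Proof.
have thb (y : g) : bilin (fun (f : Lam) x => f \ot lact x y).
  split=> [x|f]; first exact: (tens_bilin _ _).1.
  by apply: comp_lin ((tens_bilin _ _).2 f) _; exact: (lact_bilin g).1.
have ebl y : linear (ebr^~ y).
  by apply: ext_lift_lin; exact: contr_multalt (thb y).
split=> // f a y z; elim/ext_ind: f => [|c s f IH].
  by rewrite !(lin0 (ebl _)) scaler0 addr0.
rewrite !(ebl _ _ _ _) IH !ebrE.
rewrite (_ : ebr_word s (a *: y + z) = a *: ebr_word s y + ebr_word s z).
  by rewrite !scalerDr !scalerA mulrC -!addrA; congr (_ + _); rewrite addrCA.
rewrite /ebr_word scaler_sumr -big_split; apply: eq_bigr => i _ /=.
rewrite (lact_bilin g).2 (tens_bilin _ _).2 scalerDr !scalerA.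
by rewrite [a * _]mulrC.
Qed.

Let tbr_word y s t := (-1) ^ (((size s)%:Z - 1) * (size t)%:Z) *:
  wact (wd t) (ebr (wd s) y).

Let size_mid (T : Type) (s t : seq T) (x y : T) :
  size (s ++ x :: t) = size (s ++ y :: t).
Proof. by rewrite !size_cat. Qed.

Let tbr_wordl y t : multalt (tbr_word y ^~ t).
Proof.
have [Ll La] := wd_multalt (gLie g).
have l : linear (fun f => wact (wd t) (ebr f y)).
  by apply: comp_lin (ebr_bilin.1 y); exact: wact_bilin.2.
split=> [s a u v r|s v r]; last by rewrite /tbr_word La (lin0 l) scaler0.
rewrite /tbr_word Ll l scalerDr !scalerA [a * _]mulrC.
by rewrite (size_mid s r u (a *: u + v)) (size_mid s r v (a *: u + v)).
Qed.

Let tbr_wordr y s : multalt (tbr_word y s).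
Proof.
have [Ll La] := wd_multalt (gLie g).
have l : linear (fun h => wact h (ebr (wd s) y)) by exact: wact_bilin.1.
split=> [q a u v r|q v r]; last by rewrite /tbr_word La (lin0 l) scaler0.
rewrite /tbr_word Ll l scalerDr !scalerA [a * _]mulrC.
by rewrite (size_mid q r u (a *: u + v)) (size_mid q r v (a *: u + v)).
Qed.

Let tbr_bil y : bilin (fun f h => tbr f h y).
Proof. exact: ext_lift2_bilin (tbr_wordl y) (tbr_wordr y). Qed.

Lemma tbrE (p q : int) f h y :
  f \in extdeg (gLie g) p -> h \in extdeg (gLie g) q ->
  tbr f h y = (-1) ^ ((p - 1) * q) *: wact h (ebr f y).
Proof.
move=> fp hq; move: f fp; apply: extdeg_eq => [||s sp] /=.
- exact: (tbr_bil y).1.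
- apply: scale_lin; apply: comp_lin (ebr_bilin.1 y); exact: wact_bilin.2.
move: h hq; apply: extdeg_eq => [||t tq] /=.
- exact: (tbr_bil y).2.
- by apply: scale_lin; exact: wact_bilin.1.
by rewrite /tbr (ext_lift2E (tbr_wordl y) (tbr_wordr y)) /tbr_word sp tq.
Qed.

Lemma mbrE (p q : int) f h y :
  f \in extdeg (gLie g) p -> h \in extdeg (gLie g) q ->
  mbr f (h \ot y) =
    schouten f h \ot y + (-1) ^ ((p - 1) * q) *: wact h (ebr f y).
Proof.
move=> fp hq; rewrite -(tbrE y fp hq) /mbr tliftE //.
have [snl snr] := schouten_bilin schoutenP.
split=> [z|k].
  apply: add_lin; last exact: (tbr_bil z).2.
  exact: (@comp_lin _ _ _ _ (fun h => h \ot z) _ ((tens_bilin _ _).1 z) (snr f)).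
apply: add_lin; first exact: (tens_bilin _ _).2.
move=> a u v; elim/ext_ind: f {fp} => [|c s f IH].
  by rewrite !(lin0 ((tbr_bil _).1 k)) scaler0 addr0.
rewrite !((tbr_bil _).1 k) IH.
suff -> : tbr (wd s) k (a *: u + v) = a *: tbr (wd s) k u + tbr (wd s) k v.
  by rewrite !scalerDr !scalerA mulrC -!addrA; congr (_ + _); rewrite addrCA.
elim/ext_ind: k {IH} => [|d t k IHk].
  by rewrite !(lin0 ((tbr_bil _).2 _)) scaler0 addr0.
rewrite !((tbr_bil _).2 (wd s)) IHk !(tbrE _ (extdeg_wd s) (extdeg_wd t)).
rewrite (ebr_bilin.2 (wd s)) (wact_bilin.2 (wd t)) !scalerDr !scalerA.
rewrite addrACA; congr (_ *: _ + _ + _).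
by move: (_ ^ _) => e; ring.
Qed.

Lemma rhoE f x : rho (f \ot x) = f \wedge wd [:: bar x].
Proof.
rewrite /rho tliftE //; split=> [y|k]; first exact: wedge_linl.
move=> a u v; rewrite bar_lin ((wd_multalt _).1 [::]).
exact: wedge_linr.
Qed.

Lemma AmulE f x h y :
  Amul (f \ot x) (h \ot y) = (f \wedge wd [:: bar x] \wedge h) \ot y.
Proof. by rewrite /Amul rhoE wactE. Qed.

Lemma AbrE f x h y :
  Abr (f \ot x) (h \ot y) = mbr (f \wedge wd [:: bar x]) (h \ot y).
Proof. by rewrite /Abr rhoE. Qed.

End Operations.

(* A is the direct sum of the submodules deg n. *)
Record is_grading (F : fieldType) (A : lmodType F) (deg : int -> {pred A}) :
    Prop := IsGrading {
  grading_submod : forall n, submod_closed (deg n);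
  grading_span : forall a : A, exists (s : seq int) (c : int -> A),
    (forall n, c n \in deg n) /\ a = \sum_(n <- s) c n;
  grading_direct : forall (s : seq int) (c : int -> A),
    uniq s -> (forall n, c n \in deg n) -> \sum_(n <- s) c n = 0 ->
    forall n, n \in s -> c n = 0
}.

Record graded_dual_prePoisson (F : fieldType) (A : lmodType F)
    (deg : int -> {pred A}) (mul br : A -> A -> A) : Prop :=
    GradedDualPrePoisson {
  dpp_grading : is_grading deg;
  dpp_mul_bilin : bilin mul;
  dpp_br_bilin : bilin br;
  dpp_mul_deg : forall (p q : int) (x y : A),
    x \in deg p -> y \in deg q -> mul x y \in deg (p + q);
  dpp_br_deg : forall (p q : int) (x y : A),
    x \in deg p -> y \in deg q -> br x y \in deg (p + q - 1);
  dpp_mulA : associative mul;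
  dpp_mulC : forall (p q r : int) (x y z : A),
    x \in deg p -> y \in deg q -> z \in deg r ->
    mul (mul x y) z = (-1) ^ (p * q) *: mul (mul y x) z;
  dpp_loday : forall (p q r : int) (x y z : A),
    x \in deg p -> y \in deg q -> z \in deg r ->
    br x (br y z) = br (br x y) z + (-1) ^ ((p - 1) * (q - 1)) *: br y (br x z);
  dpp_derr : forall (p q r : int) (x y z : A),
    x \in deg p -> y \in deg q -> z \in deg r ->
    br x (mul y z) = mul (br x y) z + (-1) ^ ((p - 1) * q) *: mul y (br x z);
  dpp_derl : forall (p q r : int) (x y z : A),
    x \in deg p -> y \in deg q -> z \in deg r ->
    br (mul x y) z = mul x (br y z) + (-1) ^ (p * q) *: mul y (br x z);
  dpp_anti : forall (p q r : int) (x y z : A),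
    x \in deg p -> y \in deg q -> z \in deg r ->
    mul (br x y) z = - ((-1) ^ ((p - 1) * (q - 1)) *: mul (br y x) z)
}.

(* Main.v *)
Require Import Defs.
From mathcomp Require Import all_boot all_order all_algebra.
From mathcomp Require Import ring.

Set Implicit Arguments.
Unset Strict Implicit.
Unset Printing Implicit Defensive.

Import GRing.Theory.
Local Open Scope ring_scope.

(** Write Lam for the exterior algebra of g_Lie and A for Lam (x) g.  Both
    operations of A factor through the linear map rho : f (x) x |-> f /\ bar x
    from A to Lam, which preserves degrees: m * n = rho m . n for the action of
    Lam on A by wedging, and {m, n} = D_(rho m) n with D_f = [mbr f].  So the
    five identities follow from facts about the action and D alone.

    First, rho intertwines the structures: rho (f . m) = f /\ rho m and
    rho (D_f m) = {f, rho m} ([rho_wact], [rho_mbr]).  Hence a product or a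
    bracket of A standing in the left argument of an operation may be replaced
    by the wedge product or the Schouten bracket of the images under rho.
    Associativity of *, the graded symmetry in the first two factors of a
    triple product, and the skew-symmetry of {x, y} * z in x and y are then
    properties of Lam.

    Secondly, D makes A a module over the Gerstenhaber algebra Lam
    ([mbr_module], [mbr_loday]):
      D_f (h . m) = {f, h} . m + (-1)^((|f|-1)|h|) h . D_f m,
      D_(f /\ h) m = f . D_h m + (-1)^(|f||h|) h . D_f m,
      D_f (D_h m) = D_{f, h} m + (-1)^((|f|-1)(|h|-1)) D_h (D_f m).
    With f = rho x and h = rho y these are the two Leibniz rules and the Loday
    identity of A.

    The third rule is a consequence of the first two as soon as it holds when f
    and h are vectors of g_Lie, because its defect is a graded derivation in h
    ([loday_letterl]) and in f ([gm_loday]).  For vectors the bracket degree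
    |f| - 1 is zero, so the defect is moreover compatible with the action of Lam
    on m without any sign ([loday_act]).  For A this leaves the elements
    m = 1 (x) z, where D_x D_y m = 1 (x) [x, [y, z]] and the rule is the Loday
    identity of g.  The same argument for Lam acting on itself reduces the
    Jacobi identity of the Schouten bracket with two vectors, which [loday_act]
    needs, to the Jacobi identity of g_Lie.

    The homogeneous parts form a direct sum because the length of words gives
    linear projections of Lam, hence of A, onto them ([Adeg_grading]). *)

(** * Signs *)

Definition oddz (n : int) : bool := odd (absz n).

Lemma oddzD (m n : int) : oddz (m + n) = oddz m (+) oddz n.
Proof.
have sub (a c : nat) : oddz (a%:Z - c%:Z) = odd a (+) odd c.
  rewrite /oddz; case: (leqP a c) => [ac|/ltnW ca].
    by rewrite -abszN opprB subzn // absz_nat oddB // addbC.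
  by rewrite subzn // absz_nat oddB.
case: (intP m) => [|a|a]; case: (intP n) => [|c|c];
  rewrite /oddz ?add0r ?addr0 ?abszN ?addbF //.
- by rewrite -PoszD !absz_nat oddD.
- exact: sub.
- by rewrite addrC [LHS]sub addbC.
- by rewrite -opprD abszN -PoszD !absz_nat oddD.
Qed.

Lemma oddzM (m n : int) : oddz (m * n) = oddz m && oddz n.
Proof. by rewrite /oddz abszM oddM. Qed.

Lemma oddzN (m : int) : oddz (- m) = oddz m.
Proof. by rewrite /oddz abszN. Qed.

Lemma signz_oddz (R : unitRingType) (n : int) :
  (-1) ^ n = (-1) ^+ oddz n :> R.
Proof.
case: n => n; first by rewrite signr_odd.
by rewrite NegzE oddzN signr_odd /exprz /= invr_sign.
Qed.

(** Every sign identity below is an identity between the parities of integer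
    polynomials in the degrees; [signs] reduces it to the parities of the
    variables and checks all cases. *)
Ltac signs := rewrite ?exprS ?size_cat -?signz_nat !signz_oddz
  !(oddzM, oddzD, oddzN) /oddz /= ?oddD ?oddM /=;
  repeat match goal with |- context [odd ?n] => case: (odd n) end => /=; ring.

(** * Linear and bilinear maps *)
Section Bilin.
Context (F : fieldType) (U W M : lmodType F) (h : U -> W -> M).
Hypothesis hb : bilin h.
Lemma bilDl u v w : h (u + v) w = h u w + h v w.
Proof. exact: (linD (hb.1 w)). Qed.
Lemma bilZl a u w : h (a *: u) w = a *: h u w.
Proof. exact: (linZ (hb.1 w)). Qed.
Lemma bilNl u w : h (- u) w = - h u w.
Proof. exact: (linN (hb.1 w)). Qed.
Lemma bil0l w : h 0 w = 0.
Proof. exact: (lin0 (hb.1 w)). Qed.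
Lemma bilDr u v w : h u (v + w) = h u v + h u w.
Proof. exact: (linD (hb.2 u)). Qed.
Lemma bilZr a u w : h u (a *: w) = a *: h u w.
Proof. exact: (linZ (hb.2 u)). Qed.
Lemma bilNr u w : h u (- w) = - h u w.
Proof. exact: (linN (hb.2 u)). Qed.
Lemma bil0r u : h u 0 = 0.
Proof. exact: (lin0 (hb.2 u)). Qed.
End Bilin.

Lemma id_lin (F : fieldType) (U : lmodType F) : linear (fun u : U => u).
Proof. by []. Qed.

(** Linearity of an expression, read off from its outermost operation; bilinear
    operations are recognised by the [bilin] hypotheses of the context. *)
Ltac lin_step := match goal with
  | |- forall _, _ => move=> ?
  | |- GRing.linear_for _ (fun u => u) => exact: id_lin
  | |- GRing.linear_for _ (fun u => @?a u + @?c u) =>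
      apply: (add_lin (h := a) (k := c))
  | |- GRing.linear_for _ (fun u => ?c *: @?a u) => apply: (scale_lin (h := a))
  | H : bilin ?h |- GRing.linear_for _ (fun u => ?h (@?a u) ?c) =>
      apply: (comp_lin (k := fun v => h v c) (h := a) (H.1 c))
  | H : bilin ?h |- GRing.linear_for _ (fun u => ?h ?c (@?a u)) =>
      apply: (comp_lin (k := h c) (h := a) (H.2 c))
  | H : bilin ?h |- GRing.linear_for _ (?h ?c) => exact: (H.2 c)
  end.

(** * Gerstenhaber modules over an exterior algebra *)
Lemma wedgeC (F : fieldType) (V : lmodType F) (p q : int) (f h : ext V) :
  f \in extdeg V p -> h \in extdeg V q ->
  f \wedge h = (-1) ^ (p * q) *: (h \wedge f).
Proof.
have wb := @wedge_bilin F V.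
move=> fp hq; move: f fp; apply: extdeg_eq => [||s <-]; [by repeat lin_step..|].
move: h hq; apply: extdeg_eq => [||t <-]; [by repeat lin_step..|].
exact: wedge_wordC.
Qed.

Lemma subrZZ (F : fieldType) (V : lmodType F) (a c : F) (v : V) :
  a = c -> a *: v - c *: v = 0.
Proof. by move=> ->; rewrite subrr. Qed.

Section Module.
Context (F : fieldType) (L : lmodType F) (b : L -> L -> L).
Context (sn : ext L -> ext L -> ext L) (snP : is_schouten b sn).
Let wb := @wedge_bilin F L.
Let sb := schouten_bilin snP.

(** Skew-symmetry turns the Leibniz rule in the second argument into one in the
    first; the sign of the bracket being passed over f and g combines with that
    of g being moved past {f, h}, and the dependence on |h| cancels. *)
Lemma schouten_homl (p q : int) f g h :
    f \in extdeg L p -> g \in extdeg L q ->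
  sn (f \wedge g) h = f \wedge sn g h + (-1) ^ (p * q) *: (g \wedge sn f h).
Proof.
move=> fp gq; move: h; apply: ext_eq; [by repeat lin_step..|] => t.
have td := extdeg_wd t.
rewrite (schouten_anti snP (wedge_deg fp gq) td) (schouten_der snP td fp gq).
rewrite (schouten_anti snP td fp) (schouten_anti snP td gq).
rewrite (bilNl wb) (bilNr wb) (bilZl wb) (bilZr wb).
rewrite (wedgeC (schouten_deg snP fp td) gq).
rewrite [RHS]addrC scalerDr !scalerN opprD !opprK !scalerA.
rewrite -[X in _ = _ + X]scale1r.
by congr (_ *: _ + _ *: _); signs.
Qed.

Lemma schouten_homr (p q : int) f g h :
    f \in extdeg L p -> g \in extdeg L q ->
  sn f (g \wedge h) =
    sn f g \wedge h + (-1) ^ ((p - 1) * q) *: (g \wedge sn f h).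
Proof.
move=> fp gq; move: h; apply: ext_eq; [by repeat lin_step..|] => t.
exact: schouten_der snP _ _ _ _ _ _ fp gq (extdeg_wd t).
Qed.

(** The axioms of a module over a Gerstenhaber algebra, without the rule for the
    commutator of D_f and D_h: that one follows from its case of two vectors, by
    [gm_loday].  No degree of m occurs in the signs, so M carries no grading. *)
Record gerst_module (M : lmodType F) (act D : ext L -> M -> M) : Prop :=
  GerstModule {
  gm_act_bilin : bilin act;
  gm_D_bilin : bilin D;
  gm_act1 : forall m, act (wd [::]) m = m;
  gm_actA : forall f h m, act f (act h m) = act (f \wedge h) m;
  gm_derr : forall (p q : int) f h m,
    f \in extdeg L p -> h \in extdeg L q ->
    D f (act h m) = act (sn f h) m + (-1) ^ ((p - 1) * q) *: act h (D f m);
  gm_derl : forall (p q : int) f h m,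
    f \in extdeg L p -> h \in extdeg L q ->
    D (f \wedge h) m = act f (D h m) + (-1) ^ (p * q) *: act h (D f m)
}.

Lemma schouten_module : gerst_module (@wedge F L) sn.
Proof.
split=> //; [exact: wedge1l | exact: wedgeA | |].
  by move=> p q f h m fp hq; exact: schouten_homr.
by move=> p q f h m fp hq; exact: schouten_homl.
Qed.

Section Loday.
Context (M : lmodType F) (act D : ext L -> M -> M).
Hypothesis gm : gerst_module act D.
Let ab := gm_act_bilin gm.
Let db := gm_D_bilin gm.

(** The Leibniz rule for 1 /\ 1 = 1 reads D_1 m = D_1 m + D_1 m. *)
Lemma gm_D1 m : D (wd [::]) m = 0.
Proof.
have := gm_derl gm m (extdeg_wd [::]) (extdeg_wd [::]).
rewrite wedge1l !(gm_act1 gm) scale1r => /eqP.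
by rewrite -subr_eq0 opprD addrA subrr sub0r oppr_eq0 => /eqP.
Qed.

Definition loday_at (x y : L) (m : M) : Prop :=
  D (wd [:: x]) (D (wd [:: y]) m) =
  D (wd [:: b x y]) m + D (wd [:: y]) (D (wd [:: x]) m).

Lemma D_letter x h m :
  D (wd [:: x]) (act h m) = act (sn (wd [:: x]) h) m + act h (D (wd [:: x]) m).
Proof.
move: h; apply: ext_eq; [by repeat lin_step..|] => s.
rewrite (gm_derr gm m (extdeg_wd [:: x]) (extdeg_wd s)).
by rewrite subrr mul0r expr0z scale1r.
Qed.

Lemma D_cons x s m :
  D (wd (x :: s)) m =
  act (wd [:: x]) (D (wd s) m)
  + (-1) ^ (size s)%:Z *: act (wd s) (D (wd [:: x]) m).
Proof.
by rewrite wd_cons (gm_derl gm m (extdeg_wd [:: x]) (extdeg_wd s)) mul1r.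
Qed.

Lemma schouten_cons x s h :
  sn (wd (x :: s)) h =
  wd [:: x] \wedge sn (wd s) h
  + (-1) ^ (size s)%:Z *: (wd s \wedge sn (wd [:: x]) h).
Proof.
by rewrite wd_cons (schouten_homl h (extdeg_wd [:: x]) (extdeg_wd s)) mul1r.
Qed.

(** For vectors x and y, D_x and D_y are derivations without sign along the
    action, hence so is their defect d = D_x D_y - D_[x, y] - D_y D_x: one has
    d (h . m) = d' h . m + h . d m with d' the defect of x and y on Lam. *)
Lemma loday_act x y h m :
  sn (wd [:: x]) (sn (wd [:: y]) h) =
    sn (wd [:: b x y]) h + sn (wd [:: y]) (sn (wd [:: x]) h) ->
  loday_at x y m -> loday_at x y (act h m).
Proof.
rewrite /loday_at => eh em.
rewrite !D_letter !(bilDr db) !D_letter em eh (bilDl ab) (bilDr ab).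
by rewrite [LHS](AC (3 * (1 * 2)) ((1 * 5) * ((2 * 4) * (3 * 6)))%AC).
Qed.

Hypothesis loday_letters : forall x y m, loday_at x y m.

(** Induction on the length of the word h: for h = y /\ t, expanding D_h by the
    Leibniz rule in its index and moving D_x through each summand gives the
    terms of D_{x, h} and of D_h D_x. *)
Lemma loday_letterl x h m :
  D (wd [:: x]) (D h m) = D (sn (wd [:: x]) h) m + D h (D (wd [:: x]) m).
Proof.
move: h; apply: ext_eq; [by repeat lin_step..|].
elim=> [|y t IH].
  by rewrite (schouten1 [:: x] snP) (bil0l db) !gm_D1 (bil0r db) addr0.
have xtd : sn (wd [:: x]) (wd t) \in extdeg L (size t)%:Z.
  have := schouten_deg snP (extdeg_wd [:: x]) (extdeg_wd t).
  by rewrite addrAC subrr add0r.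
have -> : sn (wd [:: x]) (wd (y :: t)) =
    wd (b x y :: t) + wd [:: y] \wedge sn (wd [:: x]) (wd t).
  rewrite (wd_cons y).
  rewrite (schouten_homr (wd t) (extdeg_wd [:: x]) (extdeg_wd [:: y])).
  by rewrite (schouten_lie snP) -wd_cons subrr mul0r expr0z scale1r.
rewrite (bilDl db) !(D_cons _ t) (gm_derl gm m (extdeg_wd [:: y]) xtd) mul1r.
rewrite (bilDr db) (bilZr db) !D_letter IH loday_letters (schouten_lie snP).
rewrite !(bilDr ab) !scalerDr.
by rewrite [LHS](AC ((1 * 2) * (1 * 2)) ((1 * 5) * (2 * 4) * (3 * 6)))%AC.
Qed.

(** Induction on the length of the word f, from the case of a vector.  Besides
    the terms matched by the induction hypothesis, D_h (D_(x /\ s) m) produces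
    {h, x} . D_s m and {h, s} . D_x m; these cancel, by skew-symmetry, the
    second halves of the expansions of D_(s /\ {x, h}) m and
    D_(x /\ {s, h}) m. *)
Lemma gm_loday (p q : int) f h m :
    f \in extdeg L p -> h \in extdeg L q ->
  D f (D h m) = D (sn f h) m + (-1) ^ ((p - 1) * (q - 1)) *: D h (D f m).
Proof.
move=> fp hq; move: f fp; apply: extdeg_eq; [by repeat lin_step..|] => s <-.
move: h hq; apply: extdeg_eq; [by repeat lin_step..|] => t <-.
elim: s => [|x s IH].
  have -> : sn (wd [::]) (wd t) = 0.
    rewrite (schouten_anti snP (extdeg_wd _) (extdeg_wd _)).
    by rewrite (schouten1 t snP) scaler0 oppr0.
  by rewrite !gm_D1 (bil0l db) (bil0r db) scaler0 addr0.
have [[sd td] xd] := (extdeg_wd s, extdeg_wd t, extdeg_wd [:: x]).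
have std := schouten_deg snP sd td.
have xtd := schouten_deg snP xd td.
rewrite !(D_cons x s) IH loday_letterl (schouten_cons x s).
rewrite (bilDl db) (bilZl db).
rewrite (gm_derl gm m xd std) (gm_derl gm m sd xtd).
rewrite (bilDr db) (bilZr db) (gm_derr gm _ td xd) (gm_derr gm _ td sd).
rewrite (schouten_anti snP td xd) (schouten_anti snP td sd).
rewrite !(bilDr ab) !(bilZr ab) !(bilNl ab) !(bilZl ab).
rewrite !scalerDr !scalerN !scalerA.
(* The last group collects the two pairs that cancel. *)
rewrite [RHS](AC ((2 * 2) * (2 * 2))
  ((1 * 6) * (3 * 8) * ((2 * 7) * (4 * 5))))%AC.
rewrite -[LHS]addr0; congr (_ + _ *: _ + (_ + _ *: _) + _); [signs | signs |].
by rewrite /= !subrZZ ?addr0 //; signs.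
Qed.
End Loday.

Hypothesis jacobi : forall x y z, b x (b y z) = b (b x y) z + b y (b x z).

(** The Schouten bracket with a vector is a derivation of the exterior algebra,
    so [loday_act] for the algebra acting on itself adds one letter at a
    time. *)
Lemma schouten_jacobi_letters x y m : loday_at sn x y m.
Proof.
move: m; rewrite /loday_at; apply: ext_eq; [by repeat lin_step..|].
have lie1 u v : sn (wd [:: u]) (wd [:: v]) = wd [:: b u v].
  exact: (schouten_lie snP).
elim=> [|z s IH]; first by rewrite !(schouten1 _ snP) !(bil0r sb) addr0.
rewrite (wd_cons z); apply: (loday_act (h := wd [:: z]) schouten_module _ IH).
rewrite !lie1 jacobi.
have := (wd_multalt L).1 [::] 1 (b (b x y) z) (b y (b x z)) [::].
by rewrite /= !scale1r.
Qed.
End Module.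

(** * The module structure of Lam (x) g *)
Section LodayAlgebra.
Context (F : fieldType) (g : lodayType F).
Notation L := (gLie g).
Notation Lam := (ext L).
Notation A := (Ainfty g).
Notation sch := (@schouten F g).
Let wb := @wedge_bilin F L.
Let tb := @tens_bilin F Lam g.
Let ab := wact_bilin g.
Let eb := ebr_bilin g.
Let snP := schoutenP g.
Let sb := schouten_bilin snP.

Lemma wact1 (m : A) : wact (wd [::]) m = m.
Proof.
move: m; apply: tens_ext; [by repeat lin_step..|] => h z.
by rewrite wactE wedge1l.
Qed.

Lemma wactA f h (m : A) : wact f (wact h m) = wact (f \wedge h) m.
Proof.
move: m; apply: tens_ext; [by repeat lin_step..|] => k z.
by rewrite !wactE wedgeA.
Qed.

Lemma ebr_cons x s (y : g) :
  ebr (wd (x :: s)) y =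
  (-1) ^ (size s)%:Z *: (wd s \ot lact x y) + wact (wd [:: x]) (ebr (wd s) y).
Proof.
rewrite !ebrE -![ebr_word _ _]/(contr (fun f x => f \ot lact x y) _) contr_cons.
congr (_ + _); rewrite -contr_map; last exact: ab.2.
by apply: eq_contr => f z; rewrite wactE.
Qed.

Lemma ebr_letter x (y : g) : ebr (wd [:: x]) y = wd [::] \ot lact x y.
Proof. by rewrite ebr_cons ebr1 (bil0r ab) addr0 scale1r. Qed.

(** In {s /\ t, y} a contraction of a letter of t leaves s in front, and one of
    a letter of s leaves t at the end: moving t in front costs
    (-1)^(|t|(|s|-1)), which with the change of (-1)^(n-i) by (-1)^|t| makes
    (-1)^(|s||t|). *)
Lemma ebr_wedge (p q : int) f h (y : g) :
    f \in extdeg L p -> h \in extdeg L q ->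
  ebr (f \wedge h) y = wact f (ebr h y) + (-1) ^ (p * q) *: wact h (ebr f y).
Proof.
move=> fp hq; move: f fp; apply: extdeg_eq; [by repeat lin_step..|] => s <-.
move: h hq; apply: extdeg_eq; [by repeat lin_step..|] => t <-.
have td := extdeg_wd t.
elim: s => [|x s IH].
  by rewrite wedge1l wact1 ebr1 (bil0r ab) scaler0 addr0.
rewrite wedgeE cat_cons !ebr_cons -wedgeE IH (bilDr ab) (bilZr ab).
rewrite (bilDr ab) (bilZr ab) !wactA wactE -(wd_cons x s).
rewrite (wedgeC (extdeg_wd [:: x]) td) (wedgeC (extdeg_wd s) td).
rewrite (bilZl ab) (bilZl tb) scalerDr !scalerA.
rewrite [LHS](AC (1 * 2) (2 * (1 * 3)))%AC.
by congr (_ + (_ *: _ + _ *: _)); signs.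
Qed.

Let rho_aux : bilin (fun (f : Lam) (x : g) => f \wedge wd [:: bar x]).
Proof.
split=> [y|k]; first exact: wedge_linl.
move=> a u v; rewrite bar_lin ((wd_multalt _).1 [::]); exact: wedge_linr.
Qed.

Lemma rho_lin : linear (@rho F g).
Proof. exact: tlift_lin rho_aux. Qed.

Lemma rho_wact f (m : A) : rho (wact f m) = f \wedge rho m.
Proof.
move: m; apply: tens_ext.
- exact: comp_lin rho_lin (ab.2 f).
- exact: comp_lin (wb.2 f) rho_lin.
by move=> h z; rewrite wactE !rhoE wedgeA.
Qed.

(** Under rho the contracted letter x_i, replaced by [x_i, y], moves back from
    the last place to its own, which absorbs the sign (-1)^(n-i); the result is
    the action of bar y on f as a derivation. *)
Lemma rho_ebr f (y : g) : rho (ebr f y) = sch f (wd [:: bar y]).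
Proof.
move: f; apply: ext_eq.
- exact: (comp_lin rho_lin (eb.1 y)).
- exact: sb.1.
elim=> [|x s IH].
  rewrite ebr1 (lin0 rho_lin).
  by rewrite (gm_D1 (schouten_module snP)).
rewrite ebr_cons (linD rho_lin) (linZ rho_lin) rho_wact rhoE IH.
rewrite (schouten_cons snP) (schouten_lie snP) addrC.
congr (_ + _ *: (_ \wedge wd [:: _])).
by rewrite -[x]pi_repr -/(bar _) lieE lactE.
Qed.

(** A sign depending on the degree of a word keeps a linear map well defined on
    the exterior algebra, since the relations are homogeneous. *)
Lemma multalt_sized (V M : lmodType F) (c : nat -> F) (k : ext V -> M) :
  linear k -> multalt (fun s => c (size s) *: k (wd s)).
Proof.
move=> kl; have [Ll La] := wd_multalt V.
split=> [s a u v t|s v t]; last by rewrite La (lin0 kl) scaler0.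
by rewrite Ll kl !size_cat /= scalerDr !scalerA mulrC.
Qed.

Lemma tbr_bilin (y : g) : bilin (fun f h => tbr f h y).
Proof.
apply: ext_lift2_bilin => [t|s].
  apply: (@multalt_sized _ _ (fun n => (-1) ^ ((n%:Z - 1) * (size t)%:Z))
    (fun f => wact (wd t) (ebr f y))).
  by repeat lin_step.
apply: (@multalt_sized _ _ (fun n => (-1) ^ (((size s)%:Z - 1) * n%:Z))
    (fun h => wact h (ebr (wd s) y))).
by repeat lin_step.
Qed.

Lemma tbr_lin (f h : Lam) : linear (tbr f h : g -> A).
Proof.
move=> a u v.
move: f; apply: ext_eq.
- exact: (tbr_bilin _).1.
- apply: add_lin; last exact: (tbr_bilin _).1.
  by apply: scale_lin; exact: (tbr_bilin _).1.
move=> s; move: h; apply: ext_eq.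
- exact: (tbr_bilin _).2.
- apply: add_lin; last exact: (tbr_bilin _).2.
  by apply: scale_lin; exact: (tbr_bilin _).2.
move=> t; rewrite !(tbrE _ (extdeg_wd s) (extdeg_wd t)) (eb.2 (wd s)).
by rewrite (ab.2 (wd t)) scalerDr !scalerA mulrC.
Qed.

Let mbr_aux (f : Lam) : bilin (fun h (y : g) => sch f h \ot y + tbr f h y).
Proof.
split=> [y|h]; apply: add_lin.
- by repeat lin_step.
- exact: (tbr_bilin y).2.
- by repeat lin_step.
- exact: tbr_lin.
Qed.

Lemma mbr_bilin : bilin (@mbr F g).
Proof.
have mr f : linear (@mbr F g f) := tlift_lin (mbr_aux f).
split=> // m a f k; move: m; apply: tens_ext => [||h y].
- exact: mr.
- by apply: add_lin => //; apply: scale_lin.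
rewrite /mbr !(tliftE (mbr_aux _)) (sb.1 h) (tb.1 y) ((tbr_bilin y).1 h).
by rewrite scalerDr addrACA.
Qed.

(** Both terms defining D_f (h (x) y) go to the two terms of the Leibniz rule
    for {f, h /\ bar y}. *)
Lemma rho_mbr f (m : A) : rho (mbr f m) = sch f (rho m).
Proof.
have mb := mbr_bilin.
move: m; apply: tens_ext.
- exact: comp_lin rho_lin (mb.2 f).
- exact: comp_lin (sb.2 f) rho_lin.
move=> h y; move: f; apply: ext_eq.
- exact: comp_lin rho_lin (mb.1 _).
- exact: sb.1.
move=> s; move: h; apply: ext_eq.
- by apply: (comp_lin (h := fun h => mbr _ (h \ot y)) rho_lin); repeat lin_step.
- apply: (comp_lin (h := fun h => rho (h \ot y)) (sb.2 _)).
  exact: (comp_lin (h := fun h => h \ot y) rho_lin (tb.1 y)).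
move=> t; rewrite (mbrE _ (extdeg_wd s) (extdeg_wd t)) (linD rho_lin).
rewrite (linZ rho_lin) rho_wact !rhoE rho_ebr.
by rewrite (schouten_homr snP _ (extdeg_wd s) (extdeg_wd t)).
Qed.

Lemma mbr_module : gerst_module sch (@wact F g) (@mbr F g).
Proof.
have mb := mbr_bilin.
split=> //; [exact: wact1 | exact: wactA | |].
- move=> p q f h m fp hq.
  move: m; apply: tens_ext; [by repeat lin_step..|] => k y.
  move: k; apply: ext_eq; [by repeat lin_step..|] => t; have td := extdeg_wd t.
  rewrite !wactE (mbrE _ fp (wedge_deg hq td)) (mbrE _ fp td).
  rewrite (schouten_homr snP _ fp hq) (bilDl tb) (bilZl tb).
  rewrite (bilDr ab) (bilZr ab) !wactE wactA scalerDr scalerA addrA.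
  by congr (_ + _ *: _); signs.
move=> p q f h m fp hq.
move: m; apply: tens_ext; [by repeat lin_step..|] => k y.
move: k; apply: ext_eq; [by repeat lin_step..|] => t; have td := extdeg_wd t.
rewrite (mbrE _ (wedge_deg fp hq) td) (mbrE _ fp td) (mbrE _ hq td).
rewrite (schouten_homl snP _ fp hq) (ebr_wedge _ fp hq).
rewrite (bilDl tb) (bilZl tb) !(bilDr ab) !(bilZr ab) !wactE !wactA.
rewrite (wedgeC td fp) (wedgeC td hq) !(bilZl ab) !scalerDr !scalerA.
rewrite [LHS](AC (2 * 2) (1 * 3 * (2 * 4)))%AC.
by congr (_ + _ *: _ + (_ + _ *: _)); signs.
Qed.

Lemma lact_lie a c (z : g) :
  lact a (lact c z) = lact (lie a c) z + lact c (lact a z).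
Proof.
rewrite -[a]pi_repr -[c]pi_repr -!/(bar _).
by rewrite lieE !lactE lbr_loday.
Qed.

(** Every h (x) z is h . (1 (x) z), and on 1 (x) z the vector x acts by [x, -],
    so that only the Loday identity of g remains. *)
Lemma mbr_loday_letters x y (m : A) : loday_at (@lie F g) (@mbr F g) x y m.
Proof.
have mb := mbr_bilin.
have mbr_letter a z : mbr (wd [:: a]) (wd [::] \ot z) = wd [::] \ot lact a z :> A.
  rewrite (mbrE _ (extdeg_wd [:: a]) (extdeg_wd [::])) (schouten1 _ snP).
  by rewrite (bil0l tb) add0r ebr_letter wact1 mulr0 expr0z scale1r.
move: m; rewrite /loday_at; apply: tens_ext; [by repeat lin_step..|] => h z.
rewrite -[h]wedge1r -wactE; apply: (loday_act snP mbr_module).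
  exact: schouten_jacobi_letters snP (@lie_jacobi F g) x y h.
by rewrite /loday_at !mbr_letter lact_lie (bilDr tb).
Qed.

Lemma mbr_loday (p q : int) f h (m : A) :
    f \in extdeg L p -> h \in extdeg L q ->
  mbr f (mbr h m) =
    mbr (sch f h) m + (-1) ^ ((p - 1) * (q - 1)) *: mbr h (mbr f m).
Proof. exact: (gm_loday snP mbr_module mbr_loday_letters). Qed.

End LodayAlgebra.

(** * The grading *)
Section Grading.
Context (F : fieldType) (g : lodayType F).
Notation L := (gLie g).
Notation A := (Ainfty g).
Let tb := @tens_bilin F (ext L) g.
Let ab := wact_bilin g.

Lemma Adeg_tens (n : int) (f : ext L) (x : g) :
  f \in extdeg L (n - 1) -> f \ot x \in Adeg n.
Proof. by move=> fn; apply: mem_lspan; exists f, x. Qed.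

Lemma Adeg_word (s : seq L) (x : g) : wd s \ot x \in Adeg ((size s)%:Z + 1).
Proof. by apply: Adeg_tens; rewrite addrK extdeg_wd. Qed.

Lemma Adeg_sub (M : lmodType F) n (h : A -> M) (S : submodClosed M) :
    linear h -> (forall f x, f \in extdeg L (n - 1) -> h (f \ot x) \in S) ->
  forall m, m \in Adeg n -> h m \in S.
Proof.
move=> hl hs m; elim/lspan_ind => [|a u v [f [x [fn ->]]] IH].
  by rewrite lin0 ?rpred0.
by rewrite hl rpredD // rpredZ // hs.
Qed.

Lemma word_tens_ind (P : A -> Prop) :
    P 0 -> (forall a u v, P u -> P v -> P (a *: u + v)) ->
    (forall s x, P (wd s \ot x)) ->
  forall m, P m.
Proof.
move=> P0 PD Pw; elim/tens_ind => // a f x m Pm; apply: (PD) Pm.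
elim/ext_ind: f => [|c s f IH]; first by rewrite (bil0l tb).
by rewrite (tb.1 x); exact: PD.
Qed.

Lemma rho_deg p (m : A) : m \in Adeg p -> rho m \in extdeg L p.
Proof.
move: m; apply: Adeg_sub => [|f x fp]; first exact: rho_lin.
by rewrite rhoE -[p](subrK 1); apply: wedge_deg fp (extdeg_wd [:: _]).
Qed.

Lemma wact_deg p q f (m : A) :
  f \in extdeg L p -> m \in Adeg q -> wact f m \in Adeg (p + q).
Proof.
move=> fp; move: m; apply: Adeg_sub => [|h x hq]; first exact: ab.2.
by rewrite wactE; apply: Adeg_tens; rewrite -addrA; apply: wedge_deg.
Qed.

Lemma ebr_deg p f (y : g) : f \in extdeg L p -> ebr f y \in Adeg p.
Proof.
move: f; apply: extdeg_sub => [|s <-]; first exact: (ebr_bilin g).1.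
elim: s => [|x s IH]; first by rewrite ebr1 rpred0.
rewrite ebr_cons /= intS; apply: rpredD.
  by rewrite rpredZ //; move: (Adeg_word s (lact x y)); rewrite addrC.
exact: wact_deg (extdeg_wd [:: x]) IH.
Qed.

Lemma mbr_deg p q f (m : A) :
  f \in extdeg L p -> m \in Adeg q -> mbr f m \in Adeg (p + q - 1).
Proof.
move=> fp; move: m; apply: Adeg_sub => [|h x hq]; first exact: (mbr_bilin g).2.
rewrite (mbrE _ fp hq); apply: rpredD.
  apply: Adeg_tens; rewrite -[p + q - 1]addrA.
  exact: schouten_deg (schoutenP g) _ _ _ _ fp hq.
by rewrite rpredZ //; move: (wact_deg hq (ebr_deg x fp)); rewrite addrC addrA.
Qed.

Definition ext_part (n : int) : ext L -> ext L :=
  ext_lift (fun s => ((size s)%:Z == n)%:R *: wd s).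

Definition Apart (n : int) : A -> A :=
  tlift (fun f x => ext_part (n - 1) f \ot x).

Let ext_part_aux n : multalt (fun s : seq L => ((size s)%:Z == n)%:R *: wd s) :=
  multalt_sized (fun k => (k%:Z == n)%:R) (@id_lin F (ext L)).

Let Apart_aux n : bilin (fun f (x : g) => ext_part (n - 1) f \ot x).
Proof.
split=> [x|f]; last exact: tb.2.
exact: (comp_lin (tb.1 x) (ext_lift_lin (ext_part_aux _))).
Qed.

Lemma Apart_lin n : linear (Apart n).
Proof. exact: tlift_lin. Qed.

Lemma Apart_word n s x :
  Apart n (wd s \ot x) = ((size s)%:Z + 1 == n)%:R *: (wd s \ot x).
Proof.
rewrite /Apart tliftE // /ext_part (ext_liftE (ext_part_aux _)) (bilZl tb).
by rewrite eq_sym subr_eq eq_sym.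
Qed.

Lemma Apart_deg n p m : m \in Adeg p -> Apart n m = (p == n)%:R *: m.
Proof.
elim/lspan_ind => [|a _ m' [f [x [fp ->]]] IH].
  by rewrite (lin0 (Apart_lin n)) scaler0.
rewrite Apart_lin IH scalerDr !scalerA mulrC -!scalerA; congr (_ *: _ + _).
move: f fp; apply: extdeg_eq.
- exact: comp_lin (Apart_lin n) (tb.1 x).
- by apply: scale_lin; exact: tb.1.
by move=> s sp; rewrite Apart_word sp subrK.
Qed.

Lemma Apart_in n m : Apart n m \in Adeg n.
Proof.
elim/word_tens_ind: m => [|a u v un vn|s x].
- by rewrite (lin0 (Apart_lin n)) rpred0.
- by rewrite Apart_lin rpredD // rpredZ.
rewrite Apart_word; case: eqP => [<-|_]; last by rewrite scale0r rpred0.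
by rewrite scale1r; exact: Adeg_word.
Qed.

Lemma Apart_sum (m : A) :
  exists N, forall M, (N <= M)%N -> m = \sum_(0 <= i < M) Apart i%:Z m.
Proof.
elim/word_tens_ind: m => [|a u v [N uN] [K vK]|s x].
- by exists 0%N => M _; rewrite big1 // => i _; rewrite (lin0 (Apart_lin _)).
- exists (maxn N K) => M; rewrite geq_max => /andP[NM KM].
  rewrite (eq_bigr _ (fun i _ => Apart_lin i%:Z a u v)) big_split /=.
  by rewrite -scaler_sumr -(uN M NM) -(vK M KM).
exists (size s).+2 => M sM.
rewrite (bigD1_seq (size s).+1) ?mem_index_iota ?iota_uniq //=.
rewrite Apart_word -PoszD addn1 eqxx scale1r big1 ?addr0 // => i /negPf si.
by rewrite Apart_word -PoszD addn1 eqz_nat eq_sym si scale0r.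
Qed.

(** The projections [Apart n] decompose every element, and they recover the
    summands of a sum of homogeneous elements, which makes the sum direct. *)
Lemma Adeg_grading : is_grading (@Adeg F g).
Proof.
split=> [n|m|s c us cs s0 n ns]; first exact: lspan_submod_closed.
  have [N mN] := Apart_sum m.
  exists [seq i%:Z | i <- index_iota 0 N], (Apart^~ m).
  by split=> [n|]; [exact: Apart_in | rewrite big_map; exact: mN].
rewrite -[LHS](_ : Apart n (\sum_(i <- s) c i) = c n).
  by rewrite s0 (lin0 (Apart_lin n)).
rewrite (lin_sum (Apart_lin n)) (bigD1_seq n) //= (Apart_deg _ (cs n)) eqxx.
rewrite scale1r big1 ?addr0 // => i /negPf ni.
by rewrite (Apart_deg _ (cs i)) ni scale0r.
Qed.

End Grading.

(** * The dual-prePoisson structure *)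
Theorem corollary4p9 (F : fieldType) (charF0 : [pchar F] =i pred0)
    (g : lodayType F) :
  graded_dual_prePoisson (@Adeg F g) (@Amul F g) (@Abr F g).
Proof.
have [al ar] := wact_bilin g; have [ml mr] := mbr_bilin g.
have rl := @rho_lin F g.
have mg := mbr_module g.
have mE (x y : Ainfty g) : Amul x y = wact (rho x) y by [].
have bE (x y : Ainfty g) : Abr x y = mbr (rho x) y by [].
have rm (x y : Ainfty g) : rho (Amul x y) = rho x \wedge rho y := rho_wact _ y.
have rb (x y : Ainfty g) : rho (Abr x y) = schouten (rho x) (rho y).
  exact: rho_mbr.
split.
- exact: Adeg_grading.
- by split=> m; [exact: comp_lin (al m) rl | exact: ar].
- by split=> m; [exact: comp_lin (ml m) rl | exact: mr].
- by move=> p q x y /rho_deg xp yq; exact: wact_deg.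
- by move=> p q x y /rho_deg xp yq; exact: mbr_deg.
- by move=> x y z; rewrite (mE (Amul x y)) rm -wactA.
- move=> p q r x y z /rho_deg xp /rho_deg yq _.
  rewrite (mE (Amul x y)) (mE (Amul y x)) !rm (wedgeC xp yq).
  exact: bilZl (wact_bilin g) _ _ _.
- move=> p q r x y z /rho_deg xp /rho_deg yq _.
  by rewrite (bE (Abr x y)) rb; exact: mbr_loday.
- move=> p q r x y z /rho_deg xp /rho_deg yq _.
  by rewrite (mE (Abr x y)) rb; exact: (gm_derr mg).
- move=> p q r x y z /rho_deg xp /rho_deg yq _.
  by rewrite (bE (Amul x y)) rm; exact: (gm_derl mg).
move=> p q r x y z /rho_deg xp /rho_deg yq _.
rewrite (mE (Abr x y)) (mE (Abr y x)) !rb (schouten_anti (schoutenP g) xp yq).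
by rewrite (bilNl (wact_bilin g)) (bilZl (wact_bilin g)).
Qed.
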